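(* Let $X$ be a compact complex manifold and $E\to X$ a holomorphic vector bundle with hermitian metric $h$. The isomorphism $\Phi:D^1(E)\to A(E)$ given locally by $$\Phi: g_\alpha+d_\alpha\longmapsto\left(g_\alpha-\bar h_\alpha^{-1}d_\alpha\bar h_\alpha,\ d_\alpha\right)$$ intertwines the brackets $[-,-]$ on $\Omega^{0,\bullet}(D^1(E))$ and $[-,-]_h$ on $\Omega^{0,\bullet}(A(E))$, i.e. $$\Phi[\varphi\otimes P,\psi\otimes R]=[\varphi\otimes\Phi(P),\psi\otimes\Phi(R)]_h$$ for all $\varphi,\psi\in\Omega^{0,\bullet}$ and sections $P,R$ of $D^1(E)$.
   Context: $T_X$ is the holomorphic tangent bundle and $\Omega^{0,q}(V)$ denotes smooth $V$-valued $(0,q)$-forms. $D^1(E)$ is the bundle of differential operators on $E$ of order at most $1$ with scalar principal symbol: in a local holomorphic frame of $E$ over a coordinate open set $U_\alpha$ with holomorphic coordinates $z^k$, a section is $P=g_\alpha+d_\alpha$, with $g_\alpha$ a matrix of functions and $d_\alpha=\sum_kh^k\frac{\partial}{\partial z^k}$ acting componentwise; the symbol map $\sigma:D^1(E)\to T_X$ is $\sigma(P)=\sum_kh^k\frac{\partial}{\partial z^k}$. $h_\alpha$ is the matrix of $h$ in the local holomorphic frame, so that the Chern connection $\nabla$ of $h$ has connection matrix $\bar h_\alpha^{-1}\partial\bar h_\alpha$. The bracket on $\Omega^{0,\bullet}(D^1(E))$ is $$[\omega\otimes P,\eta\otimes R]:=\omega\wedge\eta\otimes[P,R]+\omega\wedge\mathcal{L}_{\sigma(P)}\eta\otimes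 R-(-1)^{|\omega||\eta|}\eta\wedge\mathcal{L}_{\sigma(R)}\omega\otimes P,$$ where $[P,R]$ is the commutator of operators and $\mathcal{L}_v\omega=v\lrcorner\partial\omega$ for $\omega\in\Omega^{0,\bullet}$ and $v\in\Omega^0(T_X)$. $A(E)=\mathrm{End}(E)\oplus T_X$ as smooth bundle, and for $(A,\varphi)\in\Omega^{0,p}(A(E))$, $(B,\psi)\in\Omega^{0,q}(A(E))$, $$[(A,\varphi),(B,\psi)]_h:=(\varphi\lrcorner\nabla^QB-(-1)^{pq}\psi\lrcorner\nabla^QA+[A,B],\ [\varphi,\psi]),$$ where $\nabla^Q$ is the connection on $\mathrm{End}(E)$ induced by the Chern connection $\nabla$ of $h$; for $\varphi=\varphi_J^i\,d\bar z^J\otimes\frac{\partial}{\partial z^i}$, $\varphi\lrcorner\alpha:=\varphi_J^i\,d\bar z^J\wedge(\frac{\partial}{\partial z^i}\lrcorner\alpha)$; $[A,B]=A\wedge B-(-1)^{pq}B\wedge A$; $[\varphi,\psi]=d\bar z^I\wedge d\bar z^J\otimes[\varphi_I^i\partial_{z^i},\psi_J^j\partial_{z^j}]$. $\Phi$ is extended to forms by $\Phi(\omega\otimes P)=\omega\otimes\Phi(P)$. *)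

(* Defs.v *)
From HB Require Import structures.
From mathcomp Require Import all_boot all_order all_algebra.
From mathcomp Require Import complex.
From mathcomp Require Import all_classical all_reals all_analysis.

Set Implicit Arguments.
Unset Strict Implicit.
Unset Printing Implicit Defensive.

Import Order.TTheory GRing.Theory Num.Theory.
Import numFieldNormedType.Exports.

Local Open Scope classical_set_scope.
Local Open Scope complex_scope.
Local Open Scope ring_scope.

(* C^n is R^(n+n): the real coordinates of index [lshift n k] and [rshift n k]
   are the real and imaginary parts of the k-th complex coordinate. *)

Definition iter_derive (R : realType) (m : nat) (vs : seq 'rV[R]_m)
    (f : 'rV[R]_m -> R) : 'rV[R]_m -> R :=
  foldr (fun v g => fun y => 'D_v g y) f vs.

(* C^oo on an open set: every iterated directional derivative is (Frechet)
   differentiable there. *)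
Definition smooth_real (R : realType) (m : nat) (A : set 'rV[R]_m)
    (f : 'rV[R]_m -> R) : Prop :=
  forall (vs : seq 'rV[R]_m) (y : 'rV[R]_m),
    A y -> differentiable (iter_derive vs f) y.

Definition smooth_cplx (R : realType) (m : nat) (A : set 'rV[R]_m)
    (f : 'rV[R]_m -> R[i]) : Prop :=
  smooth_real A (fun y => complex.Re (f y)) /\
  smooth_real A (fun y => complex.Im (f y)).

Definition derive_cplx (R : realType) (m : nat) (v : 'rV[R]_m)
    (f : 'rV[R]_m -> R[i]) (y : 'rV[R]_m) : R[i] :=
  ('D_v (fun u => complex.Re (f u)) y) +i* ('D_v (fun u => complex.Im (f u)) y).

(* Wirtinger derivatives: the index [lshift n k] stands for d/dz^k and
   [rshift n k] for d/dzbar^k. *)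
Definition wirtinger (R : realType) (n : nat) (a : 'I_(n + n))
    (f : 'rV[R]_(n + n) -> R[i]) (y : 'rV[R]_(n + n)) : R[i] :=
  match fintype.split a with
  | inl k => 2^-1 * (derive_cplx (delta_mx 0 (lshift n k)) f y
                     - 'i%C * derive_cplx (delta_mx 0 (rshift n k)) f y)
  | inr k => 2^-1 * (derive_cplx (delta_mx 0 (lshift n k)) f y
                     + 'i%C * derive_cplx (delta_mx 0 (rshift n k)) f y)
  end.

(* The holomorphic atlas condition says that the complex coordinate functions
   of one chart satisfy the Cauchy-Riemann equations in any other chart. The
   values of [coord a] outside [dom a] and of [icoord a] outside the image of
   [dom a] are irrelevant. *)
Record complexManifold (R : realType) (n : nat) := ComplexManifold {
  pt : topologicalType;
  chart : Type;
  dom : chart -> set pt;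
  coord : chart -> pt -> 'rV[R]_(n + n);
  icoord : chart -> 'rV[R]_(n + n) -> pt;
  manifold_hausdorff : hausdorff_space pt;
  manifold_second_countable : @second_countable pt;
  dom_open : forall a, open (dom a);
  dom_cover : forall x, exists a, dom a x;
  coord_open : forall a, open (coord a @` dom a);
  coordK : forall a x, dom a x -> icoord a (coord a x) = x;
  coord_continuous : forall a x, dom a x -> {for x, continuous (coord a)};
  icoord_continuous : forall a x, dom a x ->
    {for coord a x, continuous (icoord a)};
  coord_holomorphic : forall a b (k : 'I_n),
    let w := fun y : 'rV[R]_(n + n) =>
      coord a (icoord b y) 0 (lshift n k) +i*
      coord a (icoord b y) 0 (rshift n k) in
    smooth_cplx (coord b @` (dom a `&` dom b)) w /\
    forall (l : 'I_n) y, (coord b @` (dom a `&` dom b)) y ->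
      wirtinger (rshift n l) w y = 0
}.

Section OnManifold.
Context {R : realType} {n : nat} (X : complexManifold R n).
Local Notation C := R[i].
Implicit Types (a b : chart X) (x : pt X).

(* The 2n complex functions z^1, ..., z^n, zbar^1, ..., zbar^n. *)
Definition zeta a (i : 'I_(n + n)) (x : pt X) : C :=
  match fintype.split i with
  | inl k => coord a x 0 (lshift n k) +i* coord a x 0 (rshift n k)
  | inr k => coord a x 0 (lshift n k) -i* coord a x 0 (rshift n k)
  end.

Definition smooth a (U : set (pt X)) (f : pt X -> C) : Prop :=
  smooth_cplx (coord a @` U) (fun y => f (icoord a y)).

Definition smoothM a (U : set (pt X)) (m l : nat) (F : pt X -> 'M[C]_(m, l)) :=
  forall i j, smooth a U (fun x => F x i j).

Definition pd a (i : 'I_(n + n)) (f : pt X -> C) (x : pt X) : C :=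
  wirtinger i (fun y => f (icoord a y)) (coord a x).

Definition pdM a (i : 'I_(n + n)) (m l : nat) (F : pt X -> 'M[C]_(m, l))
    (x : pt X) : 'M[C]_(m, l) :=
  \matrix_(s, t) pd a i (fun y => F y s t) x.

Definition holomorphicM a (U : set (pt X)) (m l : nat)
    (F : pt X -> 'M[C]_(m, l)) : Prop :=
  smoothM a U F /\ forall (k : 'I_n) x, U x -> pdM a (rshift n k) F x = 0.

(* The (1,0)-vector \sum_k v^k d/dz^k at x, acting on functions. *)
Definition vec a (v : 'rV[C]_n) (f : pt X -> C) (x : pt X) : C :=
  \sum_(k < n) v 0 k * pd a (lshift n k) f x.

Definition vecM a (v : 'rV[C]_n) (m l : nat) (F : pt X -> 'M[C]_(m, l))
    (x : pt X) : 'M[C]_(m, l) :=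
  \sum_(k < n) v 0 k *: pdM a (lshift n k) F x.

Definition vf_bracket a (v w : pt X -> 'rV[C]_n) (x : pt X) : 'rV[C]_n :=
  \row_k (vec a (v x) (fun y => w y 0 k) x - vec a (w x) (fun y => v y 0 k) x).

(* A V-valued form in a chart is the family of its coefficients on the monomials
   dzeta^K, the wedge product of the dzeta^i, i in K, in increasing order. *)
Definition lform (V : Type) := {set 'I_(n + n)} -> pt X -> V.

(* dzeta^I /\ dzeta^J = (-1)^(ninv I J) dzeta^(I :|: J) for disjoint I, J *)
Definition ninv (I J : {set 'I_(n + n)}) : nat :=
  #|[set ij : 'I_(n + n) * 'I_(n + n) |
      [&& ij.1 \in I, ij.2 \in J & (ij.2 < ij.1)%N]]%SET|.

(* \sum_(I, J) dzeta^I /\ dzeta^J (x) op w_I e_J *)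
Definition wedge_op (V1 V2 : Type) (V : zmodType)
    (op : (pt X -> V1) -> (pt X -> V2) -> pt X -> V)
    (w : lform V1) (e : lform V2) : lform V :=
  fun K x => \sum_(I : {set 'I_(n + n)} | I \subset K)
    op (w I) (e (K :\: I)) x *~ (-1) ^+ ninv I (K :\: I).

Definition wedge (w e : lform C) : lform C :=
  wedge_op (fun f g x => f x * g x) w e.

Definition wedgeM (m : nat) (A B : lform 'M[C]_m) : lform 'M[C]_m :=
  wedge_op (fun f g x => f x *m g x) A B.

Definition wedgeZ (V : lmodType C) (w : lform C) (e : lform V) : lform V :=
  wedge_op (fun f g x => f x *: g x) w e.

Definition contr (V : zmodType) (i : 'I_(n + n)) (w : lform V) : lform V :=
  fun K x => if i \in K then 0 else w (i |: K) x *~ (-1) ^+ ninv [set i]%SET K.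

Definition vcontr (v : pt X -> 'rV[C]_n) (w : lform C) : lform C :=
  fun K x => \sum_(k < n) v x 0 k * contr (lshift n k) w K x.

Definition dform0 a (f : pt X -> C) : lform C :=
  fun K x => \sum_(i | K == [set i]%SET) pd a i f x.

Definition del a (w : lform C) : lform C :=
  fun K x => \sum_(k < n | lshift n k \in K)
    pd a (lshift n k) (w (K :\ lshift n k)) x
      *~ (-1) ^+ ninv [set lshift n k]%SET (K :\ lshift n k).

Definition dformM a (m : nat) (B : lform 'M[C]_m) : lform 'M[C]_m :=
  fun K x => \sum_(i in K)
    pdM a i (B (K :\ i)) x *~ (-1) ^+ ninv [set i]%SET (K :\ i).

Definition lie a (v : pt X -> 'rV[C]_n) (w : lform C) : lform C :=
  vcontr v (del a w).

Definition one_form : lform C := fun K _ => (K == finset.set0)%:R.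

(* [w], given by its coefficients in the chart a, is rewritten in the chart b by
   substituting for each dzeta_a^i its expression in the chart b. *)
Definition change_form a b (w : lform C) : lform C :=
  fun K x => \sum_(I : {set 'I_(n + n)})
    w I x * (\big[wedge/one_form]_(i <- enum I) dform0 b (zeta a i)) K x.

Definition bars : {set 'I_(n + n)} := [set rshift n k | k : 'I_n]%SET.

Definition Omega0 (q : nat) (w : chart X -> lform C) : Prop :=
  [/\ forall a K, smooth a (dom a) (w a K),
      forall a (K : {set 'I_(n + n)}) x, dom a x -> ~~ ((K \subset bars) && (#|K| == q)) ->
        w a K x = 0 &
      forall a b K x, dom a x -> dom b x ->
        w b K x = change_form a b (w a) K x].

(* A holomorphic vector bundle of rank r is given by its cocycle over an atlas
   whose charts trivialise it (any atlas can be refined to such a one).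
   [trans a b] relates the components of a section in the frames over dom a and
   dom b by s_a = trans a b *m s_b. *)
Record holBundle (r : nat) := HolBundle {
  trans : chart X -> chart X -> pt X -> 'M[C]_r;
  trans_holomorphic : forall a b, holomorphicM a (dom a `&` dom b) (trans a b);
  trans_id : forall a x, dom a x -> trans a a x = 1%:M;
  trans_cocycle : forall a b c x, dom a x -> dom b x -> dom c x ->
    trans a b x *m trans b c x = trans a c x
}.

Section OnBundle.
Context {r : nat} (E : holBundle r).

Definition conjM (m l : nat) (F : 'M[C]_(m, l)) : 'M[C]_(m, l) :=
  map_mx (@Num.conj C) F.

(* (herm a)_ij = h(e_i, e_j), with h linear in the first argument. *)
Record hermMetric := HermMetric {
  herm : chart X -> pt X -> 'M[C]_r;
  herm_smooth : forall a, smoothM a (dom a) (herm a);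
  herm_hermitian : forall a x, dom a x -> (herm a x)^T = conjM (herm a x);
  herm_positive : forall a x (v : 'cV[C]_r), dom a x -> v != 0 ->
    0 < (v^T *m herm a x *m conjM v) 0 0;
  herm_trans : forall a b x, dom a x -> dom b x ->
    herm b x = (trans E a b x)^T *m herm a x *m conjM (trans E a b x)
}.

(* The common local model of the fibres of D^1(E) and of A(E): the pair (g, v)
   is g + \sum_k v^k d/dz^k, respectively an element of End(E) (+) T_X. *)
Local Notation fib := ('M[C]_r * 'rV[C]_n)%type.

(* Families of local expressions, one per chart; for D^1(E)- and A(E)-valued
   forms as well. *)
Definition lsec := chart X -> pt X -> fib.
Definition fform := chart X -> lform fib.

Definition act a (P : pt X -> fib) (s : pt X -> 'cV[C]_r) (x : pt X)
    : 'cV[C]_r :=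
  (P x).1 *m s x + vecM a (P x).2 s x.

Definition smooth_fib (P : lsec) : Prop :=
  forall a, smoothM a (dom a) (fun x => (P a x).1) /\
            smoothM a (dom a) (fun x => (P a x).2).

(* The local operators agree on overlaps, as operators on sections of E. *)
Definition D1_section (P : lsec) : Prop :=
  smooth_fib P /\
  forall a b (s : pt X -> 'cV[C]_r), smoothM b (dom a `&` dom b) s ->
    forall x, dom a x -> dom b x ->
      act a (P a) (fun y => trans E a b y *m s y) x =
      trans E a b x *m act b (P b) s x.

Definition A_section (Q : lsec) : Prop :=
  smooth_fib Q /\
  forall a b x, dom a x -> dom b x ->
    (Q a x).1 *m trans E a b x = trans E a b x *m (Q b x).1 /\
    forall k : 'I_n, (Q a x).2 0 k = vec b (Q b x).2 (zeta a (lshift n k)) x.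

(* The commutator [P, R] of operators: the section of D^1(E) that acts on
   sections of E as P \o R - R \o P. It is meaningful on the chart domains. *)
Definition is_commutator (P R' Q : lsec) : Prop :=
  forall a (s : pt X -> 'cV[C]_r), smoothM a (dom a) s ->
    forall x, dom a x ->
      act a (Q a) s x =
      act a (P a) (act a (R' a) s) x - act a (R' a) (act a (P a) s) x.

Definition commutator (P R' : lsec) : lsec :=
  xget (fun _ _ => 0) [set Q | D1_section Q /\ is_commutator P R' Q].

Definition symbol (P : lsec) (a : chart X) (x : pt X) : 'rV[C]_n := (P a x).2.

Definition tensor (w : chart X -> lform C) (P : lsec) : fform :=
  fun a K x => w a K x *: P a x.

(* [w (x) P, e (x) S] for w of degree p and e of degree q *)
Definition bracketD (p q : nat) (w : chart X -> lform C) (P : lsec)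
    (e : chart X -> lform C) (S : lsec) : fform :=
  fun a K x =>
    tensor (fun b => wedge (w b) (e b)) (commutator P S) a K x
    + tensor (fun b => wedge (w b) (lie b (symbol P b) (e b))) S a K x
    - (-1) ^+ (p * q) *:
      tensor (fun b => wedge (e b) (lie b (symbol S b) (w b))) P a K x.

Section Metric.
Variable h : hermMetric.

(* matrix of (1,0)-forms of the Chern connection: hbar^-1 del hbar *)
Definition chern a : lform 'M[C]_r :=
  fun K x => \sum_(k < n | K == [set lshift n k]%SET)
    invmx (conjM (herm h a x))
    *m pdM a (lshift n k) (fun y => conjM (herm h a y)) x.

(* The connection induced on End(E), extended to End(E)-valued q-forms. *)
Definition nablaQ a (q : nat) (B : lform 'M[C]_r) : lform 'M[C]_r :=
  fun K x => dformM a B K x + wedgeM (chern a) B K x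
             - (-1) ^+ q *: wedgeM B (chern a) K x.

Definition contr_form (f : lform 'rV[C]_n) (al : lform 'M[C]_r)
    : lform 'M[C]_r :=
  fun K x => \sum_(k < n)
    wedgeZ (fun J y => f J y 0 k) (contr (lshift n k) al) K x.

(* [u, v]_h for u of degree p and v of degree q *)
Definition bracketH (p q : nat) (u v : fform) : fform :=
  fun a K x =>
    let A := fun J y => (u a J y).1 in let f := fun J y => (u a J y).2 in
    let B := fun J y => (v a J y).1 in let g := fun J y => (v a J y).2 in
    (contr_form f (nablaQ a q B) K x
     - (-1) ^+ (p * q) *: contr_form g (nablaQ a p A) K x
     + (wedgeM A B K x - (-1) ^+ (p * q) *: wedgeM B A K x),
     wedge_op (vf_bracket a) f g K x).

Definition Phi a (x : pt X) (P : fib) : fib :=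
  (P.1 - invmx (conjM (herm h a x))
         *m vecM a P.2 (fun y => conjM (herm h a y)) x,
   P.2).

Definition Phi_sec (P : lsec) : lsec := fun a x => Phi a x (P a x).

Definition Phi_form (u : fform) : fform := fun a K x => Phi a x (u a K x).

(* Phi is a well-defined isomorphism of smooth vector bundles D^1(E) -> A(E):
   fibrewise linear and bijective, and it matches the smooth sections. *)
Definition Phi_isomorphism : Prop :=
  (forall a x, dom a x -> linear (Phi a x) /\ bijective (Phi a x)) /\
  (forall P : lsec, D1_section P <-> A_section (Phi_sec P)).

End Metric.
End OnBundle.
End OnManifold.

(* Main.v *)
Require Import Defs.
From mathcomp Require Import all_boot all_order all_algebra.
From mathcomp Require Import complex.
From mathcomp Require Import all_classical all_reals all_analysis.
From mathcomp Require Import ring lra.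

Set Implicit Arguments.
Unset Strict Implicit.
Unset Printing Implicit Defensive.

Import Order.TTheory GRing.Theory Num.Theory.
Import numFieldNormedType.Exports.
Import Defs.

Local Open Scope classical_set_scope.
Local Open Scope complex_scope.
Local Open Scope ring_scope.

(* In the frame over a chart put theta(v) = hbar^-1 v(hbar), the contraction of
   the Chern connection matrix with a vector v of type (1,0), so that
   Phi(g + v) = (g - theta(v), v). Since the transition matrices t are
   holomorphic, v(conj t) = 0, and hbar_b = (conj t)^T hbar_a t gives the gauge
   law t theta_b = theta_a t + v(t); this turns the transformation law of
   D^1(E) into that of End(E) (+) T_X.
     For the brackets, the contraction of nabla^Q(B) with d/dz^k only sees the
   term pd_k B + [theta_k, B] when B has no dz's, and Lie derivatives act
   coefficientwise on (0,q)-forms. Collecting terms, the identity reduces to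
   the flatness v(theta(u)) - u(theta(v)) = theta([v,u]) - [theta(v), theta(u)],
   which follows from the commutation of partial derivatives. *)

(** * Real and complex differential calculus *)

(** Smoothness is phrased through iterated directional derivatives on real coordinate spaces, so
    closure properties and the symmetry of second derivatives are first built in the real case, then
    carried over to Wirtinger derivatives and charts. A section of D^1(E) is specified only by its
    action on sections of E, and the commutator is a choice among the sections with a prescribed
    action. Both are made explicit with test sections: a constant basis vector detects the matrix
    part, and z^k times a basis vector detects the k-th component of the symbol. Positive rank
    supplies the basis vector; in rank 0 the action would not determine the symbol. For forms w and
    e, both brackets are expanded in three scalar coefficients: those of w /\ e, of w /\ (Lie
    derivative of e) and of e /\ (Lie derivative of w). The first and the last also occur with their
    factors exchanged, and graded commutativity then produces the sign (-1)^(pq). *)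

Section Differentiability.
Context {R : realType} {V W : normedModType R}.

(** Write g = f + d with d vanishing near x: the remainder in the expansion of d is eventually zero,
    so d is differentiable with zero differential. *)
Lemma near_eq_differentiable (f g : V -> W) (x : V) :
  {near x, f =1 g} -> differentiable f x -> differentiable g x.
Proof.
move=> fg df; pose d := g \- f.
have -> : g = f + d by apply/funext => y; rewrite /d !fctE /= addrC subrK.
apply: differentiableD => //.
have d0 : {near x, d =1 cst 0} by near=> y; rewrite /d /= -(near fg y) ?subrr.
have dE : d \o shift x = cst (d x) + (\0 : V -> W) +o_ 0 id.
  apply/eqaddoP => _/posnumP[e]; rewrite (nbhs_singleton d0).
  have {}d0 : nbhs (0 : V) ((fun y => d y = 0) \o shift (x - 0)).
    by rewrite -[nbhs _ _](near_shift 0 x (fun y => d y = 0)).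
  apply: filterS d0 => h; rewrite /= subr0 => dh.
  by rewrite !fctE /= dh /GRing.zero /= addr0 subrr normr0 mulr_ge0.
have dd : 'd d x = \0 :> (V -> W) by apply: diff_unique => //; exact: cst_continuous.
apply/diff_locallyP; rewrite dd //; split => //; exact: cst_continuous.
Unshelve. all: by end_near. Qed.

(** The chain rule in coordinates. Decomposing g along the standard basis reduces its
    differentiability to that of its coordinates. *)
Lemma derive_comp_rV (k : nat) (f : 'rV[R]_k -> R) (g : V -> 'rV[R]_k) (x v : V) :
  (forall i, differentiable (fun y => g y 0 i) x) -> differentiable f (g x) ->
  differentiable (f \o g) x /\
  'D_v (f \o g) x =
    \sum_(i < k) 'D_(delta_mx 0 i) f (g x) * 'D_v (fun y => g y 0 i) x.
Proof.
move=> dg df.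
have gE : g = \sum_(i < k) (fun y => g y 0 i *: (delta_mx 0 i : 'rV[R]_k)).
  by apply/funext => y; rewrite fct_sumE -row_sum_delta.
have dgi i : differentiable (fun y => g y 0 i *: (delta_mx 0 i : 'rV[R]_k)) x.
  exact: differentiableZl.
have dgx : differentiable g x by rewrite gE; exact: differentiable_sum.
have dfg := differentiable_comp dgx df.
have dgE : 'd g x v = \sum_(i < k) 'D_v (fun y => g y 0 i) x *: (delta_mx 0 i : 'rV[R]_k).
  rewrite -deriveE // {1}gE derive_sum; last by move=> i; exact: diff_derivable.
  by apply: eq_bigr => i _; rewrite (deriveE v (dgi i)) diffZl //= -deriveE.
split=> //; rewrite deriveE // diff_comp //= dgE linear_sum.
by apply: eq_bigr => i _; rewrite linearZ /= -deriveE // mulrC.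
Qed.

End Differentiability.

(** * Real functions of class C^k and the symmetry of second derivatives *)

Section SmoothReal.
Context {R : realType} {m : nat}.
Local Notation V := 'rV[R]_m.
Implicit Types (A : set V) (f g : V -> R).

(** A graded form of smoothness, suited to induction: directional derivatives of order at most k are
    Frechet differentiable on A. In particular [Ck 0] is differentiability, not continuity. *)
Fixpoint Ck (k : nat) A f : Prop :=
  (forall y, A y -> differentiable f y) /\
  (if k is k'.+1 then forall v, Ck k' A ('D_v f) else True).

Lemma Ck_differentiable k A f y : Ck k A f -> A y -> differentiable f y.
Proof. by case: k => [|k] [df _]; exact: df. Qed.

Lemma Ck_derive k A f v : Ck k.+1 A f -> Ck k A ('D_v f).
Proof. by case=> _; apply. Qed.

Lemma CkW k A f : Ck k.+1 A f -> Ck k A f.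
Proof.
elim: k f => [|k IHk] f [df Df]; split => // v; exact/IHk/Df.
Qed.

Lemma smooth_realP A f : smooth_real A f <-> forall k, Ck k A f.
Proof.
split=> [sf k|Cf vs].
  elim: k f sf => [|k IHk] f sf; first by split => // y Ay; exact: (sf [::]).
  split=> [y Ay|v]; first exact: (sf [::]).
  (* [iter_derive] applies the last vector of the list first, so differentiating f itself means
     extending the list at its end. *)
  apply: IHk => vs y Ay; have := sf (rcons vs v) y Ay.
  by rewrite /iter_derive foldr_rcons.
elim/last_ind: vs f Cf => [|vs v IHvs] f Cf y Ay.
  exact: (Ck_differentiable (Cf 0%N)).
rewrite /iter_derive foldr_rcons; apply: IHvs Ay => k; exact: Ck_derive.
Qed.

Lemma sub_Ck k A B f : B `<=` A -> Ck k A f -> Ck k B f.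
Proof.
move=> BA; elim: k f => [|k IHk] f [df Df]; first by split=> // y /BA/df.
by split=> [y /BA/df //|v]; exact/IHk/Df.
Qed.

(** Openness turns equality on A into equality near each of its points, which is what derivatives
    see. The closure lemmas below use this to exchange a derivative for its explicit formula. *)
Lemma eq_Ck k A f g : open A -> (forall y, A y -> f y = g y) ->
  Ck k A f -> Ck k A g.
Proof.
move=> oA; elim: k f g => [|k IHk] f g fg [df Df].
  split=> // y Ay; apply: near_eq_differentiable (df y Ay).
  by apply: filterS fg _; exact: open_nbhs_nbhs.
split=> [y Ay|v].
  apply: near_eq_differentiable (df y Ay).
  by apply: filterS fg _; exact: open_nbhs_nbhs.
apply: IHk (Df v) => y Ay; apply: near_eq_derive.
by apply: filterS fg _; exact: open_nbhs_nbhs.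
Qed.

Lemma Ck_cst k A (c : R) : Ck k A (fun=> c).
Proof.
elim: k c => [|k IHk] c; split => // v.
rewrite (_ : 'D_v _ = (fun=> 0)) //; apply/funext => y; exact: derive_cst.
Qed.

Section OpenSet.
Context {A : set V} (oA : open A).

Lemma CkD k f g : Ck k A f -> Ck k A g -> Ck k A (fun y => f y + g y).
Proof.
elim: k f g => [|k IHk] f g [df Df] [dg Dg].
  by split=> // y Ay; apply: differentiableD; [exact: df|exact: dg].
split=> [y Ay|v]; first by apply: differentiableD; [exact: df|exact: dg].
apply: (eq_Ck oA _ (IHk _ _ (Df v) (Dg v))) => y Ay.
by rewrite -deriveD //; apply: diff_derivable; [exact: df|exact: dg].
Qed.

Lemma CkM k f g : Ck k A f -> Ck k A g -> Ck k A (fun y => f y * g y).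
Proof.
elim: k f g => [|k IHk] f g Cf Cg.
  by split=> // y Ay; apply: differentiableM; [exact: Ck_differentiable Cf _ | exact: Ck_differentiable Cg _].
split=> [y Ay|v].
  by apply: differentiableM; [exact: Ck_differentiable Cf _ | exact: Ck_differentiable Cg _].
have h1 := IHk _ _ (CkW Cf) (Ck_derive v Cg).
have h2 := IHk _ _ (CkW Cg) (Ck_derive v Cf).
apply: (eq_Ck oA _ (CkD h1 h2)) => y Ay /=.
rewrite -[RHS]/('D_v (f * g) y) deriveM //.
  by apply: diff_derivable; exact: Ck_differentiable Cf _.
by apply: diff_derivable; exact: Ck_differentiable Cg _.
Qed.

Lemma CkN k f : Ck k A f -> Ck k A (fun y => - f y).
Proof.
move=> Cf; apply: (eq_Ck oA _ (CkM (Ck_cst k A (-1)) Cf)) => y _.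
by rewrite mulN1r.
Qed.

(** The derivative of 1/f is - (1/f)^2 D f, so the induction hypothesis for 1/f one order lower
    suffices. *)
Lemma CkV k f : (forall y, A y -> f y != 0) -> Ck k A f ->
  Ck k A (fun y => (f y)^-1).
Proof.
move=> f0; elim: k => [|k IHk] Cf.
  split=> // y Ay; apply: differentiableV; last exact: f0.
  exact: Ck_differentiable Cf _.
split=> [y Ay|v].
  by apply: differentiableV; [exact: Ck_differentiable Cf _|exact: f0].
have Vf := IHk (CkW Cf).
apply: (eq_Ck oA _ (CkN (CkM (CkM Vf Vf) (Ck_derive v Cf)))) => y Ay /=.
rewrite deriveV ?f0 //; last by apply: diff_derivable; exact: Ck_differentiable Cf _.
by rewrite /GRing.scale /= mulNr expr2 invfM.
Qed.

Lemma Ck_sum k (I : Type) (s : seq I) (F : I -> V -> R) :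
  (forall i, Ck k A (F i)) -> Ck k A (fun y => \sum_(i <- s) F i y).
Proof.
move=> CF; elim: s => [|i s IHs].
  by apply: (eq_Ck oA _ (Ck_cst k A 0)) => y _; rewrite big_nil.
by apply: (eq_Ck oA _ (CkD (CF i) IHs)) => y _; rewrite big_cons.
Qed.

End OpenSet.

(** By the chain rule the derivative is a sum of products (D_i f \o g) * D_v g_i. The induction
    hypothesis applies to the first factor because it is general in f. *)
Lemma Ck_comp k A B f (g : V -> V) : open A ->
    (forall y, A y -> B (g y)) ->
    Ck k B f -> (forall i, Ck k A (fun y => g y 0 i)) ->
  Ck k A (f \o g).
Proof.
move=> oA gAB; elim: k f => [|k IHk] f Cf Cg.
  split=> // y Ay; apply: (proj1 (derive_comp_rV (0 : V) _ _)) => [i|].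
    exact: (Ck_differentiable (Cg i) Ay).
  exact: (Ck_differentiable Cf (gAB _ Ay)).
have dg i y : A y -> differentiable (fun y => g y 0 i) y.
  exact: Ck_differentiable (Cg i).
have df y : A y -> differentiable f (g y) by move=> Ay; exact: Ck_differentiable Cf (gAB _ Ay).
split=> [y Ay|v].
  by apply: (proj1 (derive_comp_rV (0 : V) _ _)) => [i|]; [exact: dg|exact: df].
pose F (i : 'I_m) := fun y => ('D_(delta_mx 0 i) f \o g) y * 'D_v (fun y => g y 0 i) y.
have CF i : Ck k A (F i).
  apply: CkM => //; last exact: Ck_derive.
  by apply: IHk => [|j]; [exact: Ck_derive|exact: CkW].
apply: (eq_Ck oA _ (Ck_sum oA (index_enum _) CF)) => y Ay.
by rewrite (proj2 (derive_comp_rV v _ _)) => [//|i|]; [exact: dg|exact: df].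
Qed.

Lemma is_derive_line f (y u : V) (s : R) :
  derivable f (y + s *: u) u ->
  is_derive s 1 (fun t : R => f (y + t *: u)) ('D_u f (y + s *: u)).
Proof.
have E : (fun h => h^-1 *: (f (y + (h *: 1 + s) *: u) - f (y + s *: u))) =
         (fun h => h^-1 *: (f (h *: u + (y + s *: u)) - f (y + s *: u))).
  apply/funext => h; congr (_ *: (f _ - _)).
  by rewrite [h *: 1]mulr1 scalerDl addrCA.
by move=> df; apply: DeriveDef; rewrite /derivable /derive /= E.
Qed.

Lemma MVT_line f (y u : V) (t : R) : 0 < t ->
  (forall s, 0 <= s <= t -> differentiable f (y + s *: u)) ->
  exists2 s, 0 < s < t & f (y + t *: u) - f y = 'D_u f (y + s *: u) * t.
Proof.
move=> t0 df.
have df' s : 0 <= s <= t ->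
    is_derive s 1 (fun t : R => f (y + t *: u)) ('D_u f (y + s *: u)).
  by move=> st; apply: is_derive_line; apply: diff_derivable; exact: df.
have [s||s st E] := @MVT R (fun s => f (y + s *: u)) (fun s => 'D_u f (y + s *: u)) 0 t t0.
- by rewrite in_itv /= => /andP[/ltW s0 /ltW st]; apply: df'; rewrite s0.
- by apply: derivable_within_continuous => s; rewrite in_itv /= => /df' [].
- by exists s => //; move: E; rewrite scale0r addr0 subr0.
Qed.

(** Two mean value theorems: along u for z |-> f (z + t v) - f z, whose derivative is an increment
    of D_u f, then along v for D_u f. *)
Lemma second_difference f (y u v : V) (t : R) : 0 < t ->
  (forall a b, 0 <= a <= t -> 0 <= b <= t ->
     differentiable f (y + a *: u + b *: v) /\
     differentiable ('D_u f) (y + a *: u + b *: v)) ->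
  exists a b, [/\ 0 < a < t, 0 < b < t &
    f (y + t *: u + t *: v) - f (y + t *: u) - (f (y + t *: v) - f y) =
    'D_v ('D_u f) (y + a *: u + b *: v) * t * t].
Proof.
move=> t0 df.
have t_itv : 0 <= t <= t by rewrite lexx ltW.
have z_itv : 0 <= (0 : R) <= t by rewrite lexx ltW.
pose g := (f \o shift (t *: v)) \- f.
have dg s : 0 <= s <= t -> differentiable g (y + s *: u) /\
    'D_u g (y + s *: u) = 'D_u f (y + s *: u + t *: v) - 'D_u f (y + s *: u).
  move=> st; have [d1 _] := df _ _ st t_itv.
  have [d2 _] := df _ _ st z_itv; rewrite scale0r addr0 in d2.
  have d3 : differentiable (f \o shift (t *: v)) (y + s *: u).
    apply: (@differentiable_comp _ _ _ _ (shift (t *: v)) f) => //.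
  split; first exact: differentiableB.
  rewrite deriveB; [|exact: diff_derivable|exact: diff_derivable].
  congr (_ - _); rewrite /derive.
  have -> : (fun h => h^-1 *: ((f \o shift (t *: v)) (h *: u + (y + s *: u))
                              - (f \o shift (t *: v)) (y + s *: u))) =
      (fun h => h^-1 *: (f (h *: u + (y + s *: u + t *: v))
                        - f (y + s *: u + t *: v))).
    by apply/funext => h /=; rewrite !addrA.
  by [].
have [a at_ aE] := MVT_line t0 (fun s st => proj1 (dg s st)).
have at' : 0 <= a <= t by case/andP: at_ => /ltW -> /ltW.
have [b bt bE] := MVT_line t0 (fun s st => proj2 (df _ _ at' st)).
exists a, b; split=> //.
rewrite -bE; move: aE; rewrite (proj2 (dg _ at')) => <-.
by rewrite /g /= [LHS]addrAC; lra.
Qed.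

(* Both mixed derivatives are limits of the same second difference quotient. *)
Lemma deriveC A f (v w y : V) : open A -> Ck 2 A f -> A y ->
  'D_v ('D_w f) y = 'D_w ('D_v f) y.
Proof.
move=> oA Cf Ay.
have D1 u z : A z -> differentiable ('D_u f) z.
  by apply: Ck_differentiable; exact: Ck_derive (CkW Cf).
have D2 u u' : {for y, continuous ('D_u ('D_u' f))}.
  apply: differentiable_continuous.
  exact: (Ck_differentiable (Ck_derive u (Ck_derive u' Cf)) Ay).
apply/eqP; rewrite -subr_eq0 -normr_le0; apply/ler_addgt0Pr => e e0.
rewrite add0r.
have [d d0 dP] : exists2 d : R, 0 < d & forall z, `|z - y| < d -> A z /\
    `|'D_v ('D_w f) y - 'D_v ('D_w f) z| < e / 2 /\
    `|'D_w ('D_v f) y - 'D_w ('D_v f) z| < e / 2.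
  have e2 : 0 < e / 2 by rewrite divr_gt0.
  have N1 : \forall z \near y, A z by apply: open_nbhs_nbhs.
  have /cvgrPdist_lt /(_ _ e2) N2 := D2 v w.
  have /cvgrPdist_lt /(_ _ e2) N3 := D2 w v.
  have [d /= d0 dP] := (nbhs_ballP _ _).1 (filterI N1 (filterI N2 N3)).
  exists d => // z zd; apply: dP; rewrite -ball_normE /= distrC //.
(* M exceeds |v| + |w| and stays positive when both vectors vanish; t is chosen so that t * M = d /
   2, which keeps all intermediate points in the ball of radius d. *)
pose M := `|v| + `|w| + 1.
have M0 : 0 < M by rewrite ltr_wpDl // addr_ge0.
pose t := d / 2 / M.
have t0 : 0 < t by rewrite !divr_gt0.
have inball a b u u' : 0 <= a <= t -> 0 <= b <= t -> `|u| + `|u'| < M ->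
    `|y + a *: u + b *: u' - y| < d.
  move=> /andP[a0 at_] /andP[b0 bt] uM.
  have -> : y + a *: u + b *: u' - y = a *: u + b *: u'.
    by rewrite [LHS]addrC -!addrA addKr.
  apply: le_lt_trans (ler_normD _ _) _; rewrite !normrZ !ger0_norm //.
  have h1 : a * `|u| <= t * `|u| by apply: ler_wpM2r.
  have h2 : b * `|u'| <= t * `|u'| by apply: ler_wpM2r.
  apply: le_lt_trans (lerD h1 h2) _; rewrite -mulrDr.
  apply: (@lt_trans _ _ (t * M)); first by rewrite ltr_pM2l.
  by rewrite /t divfK ?gt_eqF // ltr_pdivrMr // mulr_natr mulr2n ltrDl.
have vwM : `|v| + `|w| < M by rewrite ltrDl.
have wvM : `|w| + `|v| < M by rewrite addrC.
have C0 u z : A z -> differentiable f z /\ differentiable ('D_u f) z.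
  by move=> Az; split; [exact: Ck_differentiable Cf Az|exact: D1].
have [a [b [at_ bt E1]]] := second_difference t0
  (fun a b at_ bt => C0 v _ (proj1 (dP _ (inball a b v w at_ bt vwM)))).
have [a' [b' [at_' bt' E2]]] := second_difference t0
  (fun a b at_ bt => C0 w _ (proj1 (dP _ (inball a b w v at_ bt wvM)))).
have W c : 0 < c < t -> 0 <= c <= t by case/andP => /ltW -> /ltW.
have [_ [_ L1]] := dP _ (inball _ _ _ _ (W _ at_) (W _ bt) vwM).
have [_ [L2 _]] := dP _ (inball _ _ _ _ (W _ at_') (W _ bt') wvM).
have E : 'D_w ('D_v f) (y + a *: v + b *: w) = 'D_v ('D_w f) (y + a' *: w + b' *: v).
  have swap (p q r s : R) : p - q - (r - s) = p - r - (q - s) by ring.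
  have := etrans (etrans (esym E1) (swap _ _ _ _)).
  rewrite [y + t *: v + t *: w]addrAC => /(_ _ E2).
  by move=> /(mulIf (lt0r_neq0 t0)) /(mulIf (lt0r_neq0 t0)).
rewrite -(subrKA ('D_v ('D_w f) (y + a' *: w + b' *: v))).
apply: le_trans (ler_normD _ _) _.
rewrite [leRHS]splitr; apply: lerD; first exact: ltW L2.
by rewrite distrC -E; exact: ltW L1.
Qed.

End SmoothReal.

Section DeriveFun.
Context {R : realType} {V : normedModType R}.
Implicit Types f g : V -> R.

Lemma derive_funD f g (v y : V) : derivable f y v -> derivable g y v ->
  'D_v (fun u => f u + g u) y = 'D_v f y + 'D_v g y.
Proof. exact: deriveD. Qed.

Lemma derive_funN f (v y : V) : derivable f y v ->
  'D_v (fun u => - f u) y = - 'D_v f y.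
Proof. exact: deriveN. Qed.

Lemma derive_funM f g (v y : V) : derivable f y v -> derivable g y v ->
  'D_v (fun u => f u * g u) y = 'D_v f y * g y + f y * 'D_v g y.
Proof.
move=> df dg; apply: etrans (deriveM df dg) _.
by rewrite addrC /GRing.scale /= [g y * _]mulrC.
Qed.

Lemma derivable_funM f g (v y : V) : derivable f y v -> derivable g y v ->
  derivable (fun u => f u * g u) y v.
Proof. exact: derivableM. Qed.

Lemma derivable_funN f (v y : V) : derivable f y v ->
  derivable (fun u => - f u) y v.
Proof. exact: derivableN. Qed.

End DeriveFun.

(** * Smooth complex-valued functions on real spaces *)

Section SmoothComplex.
Context {R : realType} {m : nat}.
Local Notation V := 'rV[R]_m.
Local Notation C := R[i].
Implicit Types (A : set V) (f g : V -> C).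

Lemma smooth_cplxP A f : smooth_cplx A f <->
  forall k, Ck k A (fun y => complex.Re (f y)) /\ Ck k A (fun y => complex.Im (f y)).
Proof.
split=> [[/smooth_realP r /smooth_realP i] k|Cf]; first by split.
by split; apply/smooth_realP => k; case: (Cf k).
Qed.

Lemma eq_smooth_cplx A f g : open A -> (forall y, A y -> f y = g y) ->
  smooth_cplx A f -> smooth_cplx A g.
Proof.
move=> oA fg /smooth_cplxP Cf; apply/smooth_cplxP => k; have [Cr Ci] := Cf k.
by split; [apply: eq_Ck oA _ Cr|apply: eq_Ck oA _ Ci] => y Ay; rewrite fg.
Qed.

Lemma sub_smooth_cplx A B f : B `<=` A -> smooth_cplx A f -> smooth_cplx B f.
Proof.
move=> BA /smooth_cplxP Cf; apply/smooth_cplxP => k; have [Cr Ci] := Cf k.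
by split; exact: sub_Ck BA _.
Qed.

Lemma smooth_cplx_cst A (c : C) : smooth_cplx A (fun=> c).
Proof. by apply/smooth_cplxP => k; split; exact: Ck_cst. Qed.

Lemma derive_cplx_cst (v : V) (c : C) y : derive_cplx v (fun=> c) y = 0.
Proof. by rewrite /derive_cplx !derive_cst. Qed.

Lemma eq_derive_cplx (v : V) f g y :
  {near y, f =1 g} -> derive_cplx v f y = derive_cplx v g y.
Proof.
move=> fg; rewrite /derive_cplx.
by congr Complex; apply: near_eq_derive; apply: filterS fg => z /= ->.
Qed.

Section OpenSet.
Context {A : set V} (oA : open A).

Lemma smooth_cplxD f g : smooth_cplx A f -> smooth_cplx A g ->
  smooth_cplx A (fun y => f y + g y).
Proof.
move=> /smooth_cplxP Cf /smooth_cplxP Cg; apply/smooth_cplxP => k.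
have [fr fi] := Cf k; have [gr gi] := Cg k; split.
- by apply: (eq_Ck oA _ (CkD oA fr gr)) => y _; case: (f y) (g y) => ? ? [].
- by apply: (eq_Ck oA _ (CkD oA fi gi)) => y _; case: (f y) (g y) => ? ? [].
Qed.

Lemma smooth_cplxM f g : smooth_cplx A f -> smooth_cplx A g ->
  smooth_cplx A (fun y => f y * g y).
Proof.
move=> /smooth_cplxP Cf /smooth_cplxP Cg; apply/smooth_cplxP => k.
have [fr fi] := Cf k; have [gr gi] := Cg k; split.
- have h := CkD oA (CkM oA fr gr) (CkN oA (CkM oA fi gi)).
  by apply: (eq_Ck oA _ h) => y _; case: (f y) (g y) => ? ? [].
- have h := CkD oA (CkM oA fr gi) (CkM oA fi gr).
  by apply: (eq_Ck oA _ h) => y _; case: (f y) (g y) => ? ? [].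
Qed.

Lemma smooth_cplxJ f : smooth_cplx A f -> smooth_cplx A (fun y => (f y)^*%C).
Proof.
move=> /smooth_cplxP Cf; apply/smooth_cplxP => k; have [fr fi] := Cf k; split.
- by apply: (eq_Ck oA _ fr) => y _; case: (f y).
- by apply: (eq_Ck oA _ (CkN oA fi)) => y _; case: (f y).
Qed.

Lemma smooth_cplxV f : (forall y, A y -> f y != 0) -> smooth_cplx A f ->
  smooth_cplx A (fun y => (f y)^-1).
Proof.
move=> f0 /smooth_cplxP Cf; apply/smooth_cplxP => k; have [fr fi] := Cf k.
(* The parts of 1/f are those of the conjugate of f divided by this squared modulus. *)
have n0 y : A y ->
    complex.Re (f y) * complex.Re (f y) + complex.Im (f y) * complex.Im (f y) != 0.
  move=> /f0; case: (f y) => a b /=; apply: contra.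
  rewrite -!expr2 paddr_eq0 ?sqr_ge0 // !sqrf_eq0 => /andP[/eqP-> /eqP->] //.
have Vn := CkV oA n0 (CkD oA (CkM oA fr fr) (CkM oA fi fi)).
split.
- apply: (eq_Ck oA _ (CkM oA fr Vn)) => y _; case: (f y) => a b /=.
  by rewrite -!expr2.
- apply: (eq_Ck oA _ (CkN oA (CkM oA fi Vn))) => y _; case: (f y) => a b /=.
  by rewrite -!expr2 -?mulNr.
Qed.

Lemma smooth_derive_cplx v f : smooth_cplx A f -> smooth_cplx A (derive_cplx v f).
Proof.
move=> /smooth_cplxP Cf; apply/smooth_cplxP => k; have [fr fi] := Cf k.+1.
by split; apply: Ck_derive.
Qed.

Section Rules.
Context (v y : V) (Ay : A y).

Lemma smooth_cplx_derivable f : smooth_cplx A f ->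
  derivable (fun u => complex.Re (f u)) y v /\
  derivable (fun u => complex.Im (f u)) y v.
Proof.
move=> /smooth_cplxP/(_ 0%N)[fr fi].
by split; apply: diff_derivable; apply: Ck_differentiable Ay; [exact: fr|exact: fi].
Qed.

Lemma derive_cplxD f g : smooth_cplx A f -> smooth_cplx A g ->
  derive_cplx v (fun u => f u + g u) y = derive_cplx v f y + derive_cplx v g y.
Proof.
move=> /smooth_cplx_derivable[fr fi] /smooth_cplx_derivable[gr gi].
rewrite /derive_cplx.
have -> : (fun u => complex.Re (f u + g u)) =
    (fun u => complex.Re (f u) + complex.Re (g u)).
  by apply/funext => u; case: (f u) (g u) => ? ? [].
have -> : (fun u => complex.Im (f u + g u)) =
    (fun u => complex.Im (f u) + complex.Im (g u)).
  by apply/funext => u; case: (f u) (g u) => ? ? [].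
by rewrite (derive_funD fr gr) (derive_funD fi gi).
Qed.

Lemma derive_cplxM f g : smooth_cplx A f -> smooth_cplx A g ->
  derive_cplx v (fun u => f u * g u) y =
  derive_cplx v f y * g y + f y * derive_cplx v g y.
Proof.
move=> /smooth_cplx_derivable[fr fi] /smooth_cplx_derivable[gr gi].
rewrite /derive_cplx.
have -> : (fun u => complex.Re (f u * g u)) =
    (fun u => complex.Re (f u) * complex.Re (g u) +
              - (complex.Im (f u) * complex.Im (g u))).
  by apply/funext => u; case: (f u) (g u) => ? ? [].
have -> : (fun u => complex.Im (f u * g u)) =
    (fun u => complex.Re (f u) * complex.Im (g u) +
              complex.Im (f u) * complex.Re (g u)).
  by apply/funext => u; case: (f u) (g u) => ? ? [].
rewrite (derive_funD (derivable_funM fr gr) (derivable_funN (derivable_funM fi gi))).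
rewrite (derive_funD (derivable_funM fr gi) (derivable_funM fi gr)).
rewrite (derive_funN (derivable_funM fi gi)).
rewrite (derive_funM fr gr) (derive_funM fi gi) (derive_funM fr gi) (derive_funM fi gr).
move: ('D_v _ y) ('D_v _ y) ('D_v _ y) ('D_v _ y) => a b c d.
case: (f y) (g y) => p q [p' q'] /=.
apply/eqP; rewrite eq_complex /=; apply/andP; split; apply/eqP; ring.
Qed.

Lemma derive_cplxJ f : smooth_cplx A f ->
  derive_cplx v (fun u => (f u)^*%C) y = (derive_cplx v f y)^*%C.
Proof.
move=> /smooth_cplx_derivable[fr fi]; rewrite /derive_cplx /=.
have -> : (fun u => complex.Re (f u)^*%C) = (fun u => complex.Re (f u)).
  by apply/funext => u; case: (f u).
have -> : (fun u => complex.Im (f u)^*%C) = (fun u => - complex.Im (f u)).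
  by apply/funext => u; case: (f u).
by rewrite (derive_funN fi).
Qed.

Lemma derive_cplxC w f : smooth_cplx A f ->
  derive_cplx v (derive_cplx w f) y = derive_cplx w (derive_cplx v f) y.
Proof.
move=> /smooth_cplxP/(_ 2)[fr fi].
by rewrite /derive_cplx /= (deriveC _ _ oA fr Ay) (deriveC _ _ oA fi Ay).
Qed.

End Rules.
End OpenSet.
End SmoothComplex.

Lemma mul_cplxr (R : realType) (a b c : R) :
  (a +i* b) * c%:C = (a * c) +i* (b * c).
Proof. by apply/eqP; rewrite eq_complex /= !mulr0 subr0 add0r !eqxx. Qed.

Lemma add_cplx (R : realType) (a b c d : R) :
  (a +i* b) + (c +i* d) = (a + c) +i* (b + d).
Proof. by []. Qed.

Lemma opp_cplx (R : realType) (a b : R) : - (a +i* b) = (- a) +i* (- b).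
Proof. by []. Qed.

Lemma mul_cplx_i (R : realType) (a : R) : a%:C * 'i%C = 0 +i* a.
Proof. by apply/eqP; rewrite eq_complex /= !(mulr0, mul0r, mulr1, subr0, addr0) !eqxx. Qed.

Lemma sum_cplx (R : realType) (I : Type) (s : seq I) (a b : I -> R) :
  \sum_(i <- s) (a i +i* b i) = (\sum_(i <- s) a i) +i* (\sum_(i <- s) b i).
Proof.
elim: s => [|i s IHs]; first by rewrite !big_nil.
by rewrite !big_cons IHs.
Qed.

(** * Wirtinger derivatives and their chain rule *)

Section Wirtinger.
Context {R : realType} {n : nat}.
Local Notation V := 'rV[R]_(n + n).
Local Notation C := R[i].
Implicit Types (f g : V -> C) (A : set V) (a : 'I_(n + n)).

(** With [csign], this gives d/dz^k and d/dzbar^k one common formula, so that each rule is proved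
    once for both. *)
Definition cdir a : 'I_n := match fintype.split a with inl k | inr k => k end.

Definition csign a : C :=
  match fintype.split a with inl _ => - 'i%C | inr _ => 'i%C end.

Lemma wirtingerE a f y : wirtinger a f y =
  2^-1 * (derive_cplx (delta_mx 0 (lshift n (cdir a))) f y +
          csign a * derive_cplx (delta_mx 0 (rshift n (cdir a))) f y).
Proof.
by rewrite /wirtinger /cdir /csign; case: fintype.split => k //; rewrite mulNr.
Qed.

Lemma split_lshift (k : 'I_n) : fintype.split (lshift n k) = inl k :> 'I_n + 'I_n.
Proof. exact: (unsplitK (inl k)). Qed.

Lemma split_rshift (k : 'I_n) : fintype.split (rshift n k) = inr k :> 'I_n + 'I_n.
Proof. exact: (unsplitK (inr k)). Qed.

Lemma eq_wirtinger a f g y : {near y, f =1 g} -> wirtinger a f y = wirtinger a g y.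
Proof. by move=> fg; rewrite !wirtingerE !(eq_derive_cplx _ fg). Qed.

Lemma wirtinger_cst a (c : C) y : wirtinger a (fun=> c) y = 0.
Proof. by rewrite wirtingerE !derive_cplx_cst !mulr0 addr0 mulr0. Qed.

Lemma smooth_wirtinger A a f : open A -> smooth_cplx A f ->
  smooth_cplx A (wirtinger a f).
Proof.
move=> oA sf; rewrite (_ : wirtinger a f = fun y => wirtinger a f y) //.
under [X in smooth_cplx _ X]funext do rewrite wirtingerE.
apply: smooth_cplxM => //; first exact: smooth_cplx_cst.
apply: smooth_cplxD => //; first exact: smooth_derive_cplx.
apply: smooth_cplxM => //; first exact: smooth_cplx_cst.
exact: smooth_derive_cplx.
Qed.

Section Rules.
Context {A : set V} (oA : open A) {y : V} (Ay : A y).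

Lemma wirtingerD a f g : smooth_cplx A f -> smooth_cplx A g ->
  wirtinger a (fun u => f u + g u) y = wirtinger a f y + wirtinger a g y.
Proof.
move=> sf sg; rewrite !wirtingerE !(derive_cplxD _ Ay sf sg).
by rewrite -mulrDr; congr (_ * _); rewrite mulrDr addrACA.
Qed.

Lemma wirtingerM a f g : smooth_cplx A f -> smooth_cplx A g ->
  wirtinger a (fun u => f u * g u) y =
  wirtinger a f y * g y + f y * wirtinger a g y.
Proof.
move=> sf sg; rewrite !wirtingerE !(derive_cplxM _ Ay sf sg).
move: (derive_cplx _ f y) (derive_cplx _ f y) (derive_cplx _ g y) (derive_cplx _ g y).
by move: (f y) (g y) (csign a) => u w s p q r t; ring.
Qed.

Lemma wirtingerZ a (c : C) f : smooth_cplx A f ->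
  wirtinger a (fun u => c * f u) y = c * wirtinger a f y.
Proof.
move=> sf; rewrite (wirtingerM _ (smooth_cplx_cst A c) sf).
by rewrite wirtinger_cst mul0r add0r.
Qed.

Lemma wirtingerJ (k : 'I_n) f : smooth_cplx A f ->
  wirtinger (lshift n k) (fun u => (f u)^*%C) y =
  (wirtinger (rshift n k) f y)^*%C.
Proof.
move=> sf; rewrite /wirtinger split_lshift split_rshift !(derive_cplxJ _ Ay sf).
rewrite rmorphM rmorphD rmorphM; congr (_ * (_ + _)).
  by rewrite fmorphV rmorph_nat.
by apply/eqP; rewrite eq_complex /= !(oppr0, mul0r, mul1r, mulN1r, subr0, sub0r, add0r, addr0, opprK, mulr0, mulNr) !eqxx.
Qed.

Lemma derive_cplxZ v (c : C) f : smooth_cplx A f ->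
  derive_cplx v (fun u => c * f u) y = c * derive_cplx v f y.
Proof.
move=> sf; rewrite (derive_cplxM _ Ay (smooth_cplx_cst A c) sf).
by rewrite derive_cplx_cst mul0r add0r.
Qed.

End Rules.

Lemma derive_wirtinger A y v b f : open A -> A y -> smooth_cplx A f ->
  derive_cplx v (wirtinger b f) y = wirtinger b (derive_cplx v f) y.
Proof.
move=> oA Ay sf.
rewrite (_ : wirtinger b f = fun u => wirtinger b f u) //.
under [X in derive_cplx _ X]funext do rewrite wirtingerE.
have s1 u := smooth_derive_cplx u sf.
have c (z : C) := smooth_cplx_cst A z.
rewrite (derive_cplxZ Ay) ?(derive_cplxD _ Ay) ?(derive_cplxZ Ay) //; last first.
- by apply: smooth_cplxD => //; apply: smooth_cplxM.
- by apply: smooth_cplxM.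
have e u : derive_cplx v (derive_cplx u f) y = derive_cplx u (derive_cplx v f) y.
  exact: derive_cplxC sf.
by rewrite wirtingerE 2!e.
Qed.

Lemma wirtingerC A y a b f : open A -> A y -> smooth_cplx A f ->
  wirtinger a (wirtinger b f) y = wirtinger b (wirtinger a f) y.
Proof.
move=> oA Ay sf; rewrite [LHS]wirtingerE !(derive_wirtinger _ _ oA Ay sf).
rewrite [in RHS](_ : wirtinger a f = fun u => wirtinger a f u) //.
under [X in _ = wirtinger _ X _]funext do rewrite wirtingerE.
have s1 u := smooth_derive_cplx u sf.
have c (z : C) := smooth_cplx_cst A z.
have s2 := smooth_cplxM oA (c (csign a)) (s1 (delta_mx 0 (rshift n (cdir a)))).
rewrite (wirtingerZ Ay) ?(wirtingerD Ay) ?(wirtingerZ Ay) //.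
exact: smooth_cplxD.
Qed.

Definition cplx_coord (w : V -> V) (i : 'I_(n + n)) (y : V) : C :=
  match fintype.split i with
  | inl k => w y 0 (lshift n k) +i* w y 0 (rshift n k)
  | inr k => w y 0 (lshift n k) -i* w y 0 (rshift n k)
  end.

(** The real chain rule with the terms of the k-th real and imaginary parts regrouped: if P, Q are
    the partial derivatives of f and p, q those of the two real components of w, then P p + Q q = (P
    - i Q)(p + i q) / 2 + (P + i Q)(p - i q) / 2. *)
Lemma derive_cplx_comp A B f (w : V -> V) v y : open A -> A y -> B (w y) ->
    smooth_cplx B f -> (forall i, smooth_real A (fun u => w u 0 i)) ->
  derive_cplx v (f \o w) y =
  \sum_(i < n + n) wirtinger i f (w y) * derive_cplx v (cplx_coord w i) y.
Proof.
move=> oA Ay By /smooth_cplxP/(_ 0%N)[fr fi] sw.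
have dw i : differentiable (fun u => w u 0 i) y.
  by move/smooth_realP: (sw i) => /(_ 0%N) h; exact: Ck_differentiable h Ay.
have dfr := Ck_differentiable fr By; have dfi := Ck_differentiable fi By.
have -> : derive_cplx v (f \o w) y = \sum_(i < n + n)
    derive_cplx (delta_mx 0 i) f (w y) * ('D_v (fun u => w u 0 i) y)%:C.
  rewrite /derive_cplx; have [_ h1] := derive_comp_rV v dw dfr.
  have [_ h2] := derive_comp_rV v dw dfi.
  rewrite -[LHS]/(('D_v ((fun u => complex.Re (f u)) \o w) y) +i*
                  ('D_v ((fun u => complex.Im (f u)) \o w) y)) h1 h2 -sum_cplx.
  by apply: eq_bigr => i _; rewrite mul_cplxr.
rewrite !big_split_ord /= -!big_split /=; apply: eq_bigr => k _.
have dwr i : derivable (fun u => w u 0 i) y v by exact: diff_derivable.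
have -> : derive_cplx v (cplx_coord w (lshift n k)) y =
    ('D_v (fun u => w u 0 (lshift n k)) y)%:C +
    'i%C * ('D_v (fun u => w u 0 (rshift n k)) y)%:C.
  by rewrite /cplx_coord split_lshift /derive_cplx /= [in RHS]mulrC mul_cplx_i add_cplx addr0 add0r.
have -> : derive_cplx v (cplx_coord w (rshift n k)) y =
    ('D_v (fun u => w u 0 (lshift n k)) y)%:C -
    'i%C * ('D_v (fun u => w u 0 (rshift n k)) y)%:C.
  rewrite /cplx_coord split_rshift /derive_cplx /= (derive_funN (dwr _)).
  by rewrite [in RHS]mulrC mul_cplx_i opp_cplx add_cplx oppr0 addr0 add0r.
rewrite /wirtinger split_lshift split_rshift.
move: (derive_cplx _ f _) (derive_cplx _ f _) => Q P.
move: (real_complex_def _ _) (real_complex_def _ _) => q p.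
have i2 : 'i%C * 'i%C = -1 :> C by rewrite -expr2 sqr_i.
have h2 : 2^-1 * 2 = 1 :> C by rewrite mulVf // pnatr_eq0.
transitivity ((2^-1 * 2) * (P * p) - (2^-1 * 2) * (('i%C * 'i%C) * (Q * q))).
  by rewrite i2 h2 !mul1r mulN1r opprK.
by move: (2^-1) 'i%C => h i; ring.
Qed.

Lemma wirtinger_comp A B f (w : V -> V) i y : open A -> A y -> B (w y) ->
    smooth_cplx B f -> (forall j, smooth_real A (fun u => w u 0 j)) ->
  wirtinger i (f \o w) y =
  \sum_(j < n + n) wirtinger j f (w y) * wirtinger i (cplx_coord w j) y.
Proof.
move=> oA Ay By sf sw; rewrite wirtingerE.
rewrite !(derive_cplx_comp _ oA Ay By sf sw) mulr_sumr -big_split mulr_sumr /=.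
apply: eq_bigr => j _; rewrite [wirtinger i _ _]wirtingerE.
move: (wirtinger j f (w y)) (derive_cplx _ _ _) (derive_cplx _ _ _) (csign i) => W p q c.
by move: 2^-1 => h; ring.
Qed.

Lemma smooth_cplx_comp A B f (w : V -> V) : open A ->
    (forall y, A y -> B (w y)) ->
    smooth_cplx B f -> (forall j, smooth_real A (fun u => w u 0 j)) ->
  smooth_cplx A (f \o w).
Proof.
move=> oA AB /smooth_cplxP sf sw; apply/smooth_cplxP => k; have [fr fi] := sf k.
have Cw j : Ck k A (fun u => w u 0 j) by move/smooth_realP: (sw j).
split.
- exact: (@Ck_comp _ _ k A B (fun u => complex.Re (f u)) w).
- exact: (@Ck_comp _ _ k A B (fun u => complex.Im (f u)) w).
Qed.

End Wirtinger.

(** * Calculus in the charts of a complex manifold *)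

Section Calculus.
Context {R : realType} {n : nat} {X : complexManifold R n}.
Local Notation C := R[i].
Implicit Types (a b : chart X) (x : pt X) (U : set (pt X)) (f g : pt X -> C).

Lemma open_coord_image a U : open U -> U `<=` dom a -> open (coord a @` U).
Proof.
move=> oU Ua; rewrite openE => _ [x Ux <-].
have ax := Ua _ Ux.
have N1 : \forall z \near coord a x, (coord a @` dom a) z.
  by apply: open_nbhs_nbhs; split; [exact: coord_open|exists x].
have N2 : \forall z \near coord a x, U (icoord a z).
  apply: (icoord_continuous ax); rewrite coordK //.
  exact: open_nbhs_nbhs.
by apply: filterS2 N1 N2 => _ [x' ax' <-]; rewrite coordK.
Qed.

Section Local.
Context {a : chart X} {U : set (pt X)} (oU : open U) (Ua : U `<=` dom a).

Let icoord_image y : (coord a @` U) y -> U (icoord a y) /\ coord a (icoord a y) = y.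
Proof. by move=> [x Ux <-]; rewrite coordK //; exact: Ua. Qed.

Let oUa : open (coord a @` U).
Proof. exact: open_coord_image. Qed.

Lemma near_coord x : U x -> \forall z \near coord a x, (coord a @` U) z.
Proof. by move=> Ux; apply: open_nbhs_nbhs; split=> //; exists x. Qed.

Lemma eq_smooth f g : (forall x, U x -> f x = g x) -> smooth a U f -> smooth a U g.
Proof.
move=> fg; apply: eq_smooth_cplx oUa _ => y Uy; apply: fg.
exact: (icoord_image Uy).1.
Qed.

Lemma eq_pd i f g x : (forall x, U x -> f x = g x) -> U x ->
  pd a i f x = pd a i g x.
Proof.
move=> fg Ux; apply: eq_wirtinger; apply: filterS (near_coord Ux) => y Uy.
by apply: fg; exact: (icoord_image Uy).1.
Qed.

Lemma smooth_cst (c : C) : smooth a U (fun=> c).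
Proof. exact: smooth_cplx_cst. Qed.

Lemma smoothD f g : smooth a U f -> smooth a U g -> smooth a U (fun x => f x + g x).
Proof. exact: smooth_cplxD. Qed.

Lemma smoothMl f g : smooth a U f -> smooth a U g -> smooth a U (fun x => f x * g x).
Proof. exact: smooth_cplxM. Qed.

Lemma smoothN f : smooth a U f -> smooth a U (fun x => - f x).
Proof.
move=> sf; apply: (eq_smooth _ (smoothMl (smooth_cst (-1)) sf)) => x _.
by rewrite mulN1r.
Qed.

Lemma smoothB f g : smooth a U f -> smooth a U g -> smooth a U (fun x => f x - g x).
Proof. by move=> sf sg; apply: smoothD => //; exact: smoothN. Qed.

Lemma smoothJ f : smooth a U f -> smooth a U (fun x => (f x)^*%C).
Proof. exact: smooth_cplxJ. Qed.

Lemma smoothV f : (forall x, U x -> f x != 0) -> smooth a U f ->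
  smooth a U (fun x => (f x)^-1).
Proof.
move=> f0; apply: (smooth_cplxV oUa) => y Uy; apply: f0.
exact: (icoord_image Uy).1.
Qed.

Lemma smooth_sum (I : Type) (s : seq I) (P : pred I) (F : I -> pt X -> C) :
  (forall i, P i -> smooth a U (F i)) ->
  smooth a U (fun x => \sum_(i <- s | P i) F i x).
Proof.
move=> sF; elim: s => [|i s IHs].
  by apply: (eq_smooth _ (smooth_cst 0)) => x _; rewrite big_nil.
under [X in smooth _ _ X]funext do rewrite big_cons.
by case Pi: (P i) => //; apply: smoothD => //; exact: sF.
Qed.

Lemma smooth_prod (I : Type) (s : seq I) (F : I -> pt X -> C) :
  (forall i, smooth a U (F i)) -> smooth a U (fun x => \prod_(i <- s) F i x).
Proof.
move=> sF; elim: s => [|i s IHs].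
  by apply: (eq_smooth _ (smooth_cst 1)) => x _; rewrite big_nil.
under [X in smooth _ _ X]funext do rewrite big_cons.
exact: smoothMl.
Qed.

Lemma smooth_pd i f : smooth a U f -> smooth a U (pd a i f).
Proof.
move=> sf; apply: (eq_smooth_cplx oUa _ (smooth_wirtinger i oUa sf)) => y Uy.
by rewrite /pd (icoord_image Uy).2.
Qed.

Section AtPoint.
Context {x : pt X} (Ux : U x).

Let Uy : (coord a @` U) (coord a x).
Proof. by exists x. Qed.

Let xK : icoord a (coord a x) = x.
Proof. by rewrite coordK //; exact: Ua. Qed.

Lemma pd_cst i (c : C) : pd a i (fun=> c) x = 0.
Proof. exact: wirtinger_cst. Qed.

Lemma pdD i f g : smooth a U f -> smooth a U g ->
  pd a i (fun y => f y + g y) x = pd a i f x + pd a i g x.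
Proof. exact: (wirtingerD Uy). Qed.

Lemma pdMl i f g : smooth a U f -> smooth a U g ->
  pd a i (fun y => f y * g y) x = pd a i f x * g x + f x * pd a i g x.
Proof. by move=> sf sg; rewrite /pd (wirtingerM Uy _ sf sg) xK. Qed.

Lemma pdJ (k : 'I_n) f : smooth a U f ->
  pd a (lshift n k) (fun y => (f y)^*%C) x = (pd a (rshift n k) f x)^*%C.
Proof. exact: (wirtingerJ Uy). Qed.

Lemma pdC i j f : smooth a U f -> pd a i (pd a j f) x = pd a j (pd a i f) x.
Proof.
move=> sf; transitivity (wirtinger i (wirtinger j (fun y => f (icoord a y))) (coord a x)).
  apply: eq_wirtinger; apply: filterS (near_coord Ux) => y Uy'.
  by rewrite /pd (icoord_image Uy').2.
rewrite (wirtingerC _ _ oUa Uy sf).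
apply: eq_wirtinger; apply: filterS (near_coord Ux) => y Uy'.
by rewrite /pd (icoord_image Uy').2.
Qed.

End AtPoint.

Lemma sub_smooth (W : set (pt X)) f : U `<=` W -> smooth a W f -> smooth a U f.
Proof. by move=> UW; apply: sub_smooth_cplx => _ [x Ux <-]; exists x => //; exact: UW. Qed.

End Local.
End Calculus.

Lemma derive_coord (R : realType) (m : nat) (v y : 'rV[R]_m) (i : 'I_m) :
  'D_v (fun u : 'rV[R]_m => u 0 i) y = v 0 i.
Proof.
have := @derive_mx R _ 1 m id y v (@derivable_id _ _ _ _).
by rewrite derive_id => /rowP/(_ i) ->; rewrite mxE.
Qed.

(** * Change of holomorphic coordinates *)

Section ChartChange.
Context {R : realType} {n : nat} {X : complexManifold R n}.
Local Notation C := R[i].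
Implicit Types (x : pt X) (f g : pt X -> C).

Lemma transition_smooth (a b : chart X) (U : set (pt X)) (j : 'I_(n + n)) :
  U `<=` dom a -> U `<=` dom b ->
  smooth_real (coord a @` U) (fun y => coord b (icoord a y) 0 j).
Proof.
move=> Ua Ub; apply/smooth_realP => k.
have UW : coord a @` U `<=` coord a @` (dom b `&` dom a).
  by move=> _ [x Ux <-]; exists x => //; split; [exact: Ub|exact: Ua].
rewrite -(splitK j); case: (fintype.split j) => l /=; apply: (sub_Ck UW).
- by have [/smooth_cplxP/(_ k)[]] := coord_holomorphic b a l.
- by have [/smooth_cplxP/(_ k)[]] := coord_holomorphic b a l.
Qed.

Section Overlap.
Context {a b : chart X} {U : set (pt X)}.
Context (oU : open U) (Ua : U `<=` dom a) (Ub : U `<=` dom b).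

Let oUb : open (coord b @` U).
Proof. exact: open_coord_image. Qed.

Let coord_change y : (coord b @` U) y ->
  (coord a @` U) (coord a (icoord b y)) /\
  icoord a (coord a (icoord b y)) = icoord b y.
Proof.
by move=> [x Ux <-]; have [ax bx] := (Ua Ux, Ub Ux); rewrite !coordK.
Qed.

Lemma smooth_change f : smooth a U f -> smooth b U f.
Proof.
move=> sf; have sw j := transition_smooth j Ub Ua.
have UU y : (coord b @` U) y -> (coord a @` U) (coord a (icoord b y)).
  by move=> /coord_change[].
apply: (eq_smooth_cplx oUb _ (smooth_cplx_comp oUb UU sf sw)) => y Uy /=.
by rewrite (coord_change Uy).2.
Qed.

Lemma smooth_zeta (i : 'I_(n + n)) : smooth b U (zeta a i).
Proof.
have UW : coord b @` U `<=` coord b @` (dom a `&` dom b).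
  by move=> _ [x Ux <-]; exists x => //; split; [exact: Ua|exact: Ub].
have sz l := sub_smooth_cplx UW (coord_holomorphic a b l).1.
rewrite /smooth /zeta; case: (fintype.split i) => l; first exact: sz.
exact: (smooth_cplxJ oUb (sz l)).
Qed.

Lemma pd_bar_zeta (k l : 'I_n) x : U x -> pd b (rshift n l) (zeta a (lshift n k)) x = 0.
Proof.
move=> Ux; rewrite /pd /zeta split_lshift.
apply: (coord_holomorphic a b k).2; exists x => //.
by split; [exact: Ua|exact: Ub].
Qed.

(** The conjugate of the Cauchy-Riemann equation for the k-th coordinate of a. *)
Lemma pd_zetabar (k l : 'I_n) x : U x -> pd b (lshift n l) (zeta a (rshift n k)) x = 0.
Proof.
move=> Ux.
have -> : zeta a (rshift n k) = fun y => (zeta a (lshift n k) y)^*%C.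
  by apply/funext => y; rewrite /zeta split_lshift split_rshift.
by rewrite (pdJ Ux _ (smooth_zeta _)) pd_bar_zeta // conjc0.
Qed.

(* The terms in dzbar drop out because the transition map is holomorphic. *)
Lemma pd_change f (l : 'I_n) x : smooth a U f -> U x ->
  pd b (lshift n l) f x =
  \sum_(k < n) pd a (lshift n k) f x * pd b (lshift n l) (zeta a (lshift n k)) x.
Proof.
move=> sf Ux; have sw j := transition_smooth j Ub Ua.
have Uy : (coord b @` U) (coord b x) by exists x.
pose w := fun y => coord a (icoord b y).
have wx : w (coord b x) = coord a x by rewrite /w coordK //; exact: Ub.
have Uw : (coord a @` U) (w (coord b x)) by rewrite wx; exists x.
rewrite {1}/pd.
have -> : wirtinger (lshift n l) (fun y => f (icoord b y)) (coord b x) =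
    wirtinger (lshift n l) ((fun y => f (icoord a y)) \o w) (coord b x).
  apply: eq_wirtinger; apply: filterS (near_coord oU Ub Ux) => y /coord_change[_ /=].
  by rewrite /w => ->.
rewrite (wirtinger_comp _ oUb Uy Uw sf sw) big_split_ord /= wx.
rewrite [X in _ + X]big1 ?addr0 => [|k _]; last first.
  rewrite (_ : wirtinger (lshift n l) _ _ = pd b (lshift n l) (zeta a (rshift n k)) x) //.
  by rewrite pd_zetabar // mulr0.
by apply: eq_bigr.
Qed.

End Overlap.

Lemma pd_zeta (a : chart X) (k l : 'I_n) x : dom a x ->
  pd a (lshift n l) (zeta a (lshift n k)) x = (k == l)%:R.
Proof.
move=> ax; rewrite /pd.
have -> : wirtinger (lshift n l) (fun y => zeta a (lshift n k) (icoord a y)) (coord a x) =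
    wirtinger (lshift n l) (fun y => y 0 (lshift n k) +i* y 0 (rshift n k)) (coord a x).
  apply: eq_wirtinger; apply: filterS (near_coord (dom_open a) (@subset_refl _ _) ax).
  by move=> _ [z az <-]; rewrite /zeta split_lshift coordK.
rewrite /wirtinger split_lshift /derive_cplx /= !derive_coord !mxE !eqxx /=.
rewrite !(inj_eq (@lshift_inj _ _)) !(inj_eq (@rshift_inj _ _)) eq_lrshift eq_rlshift.
case: (k == l).
  rewrite -[_ +i* false%:R]/(1 : C) -[false%:R +i* _]/('i%C : C) -expr2 sqr_i opprK.
  by rewrite -mulr2n mulVf // pnatr_eq0.
by rewrite -[_ +i* _]/(0 : C) mulr0 subr0 mulr0.
Qed.

End ChartChange.

(* Unification would otherwise unfold derivatives down to limits of filters. *)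
Opaque pd smooth.

(** * Vectors of type (1,0) acting on functions and matrices *)

Section MatrixCalculus.
Context {R : realType} {n : nat} {X : complexManifold R n}.
Local Notation C := R[i].
Implicit Types (x : pt X) (f g : pt X -> C) (v w : 'rV[C]_n).

Lemma vecME (a : chart X) v (m l : nat) (F : pt X -> 'M[C]_(m, l)) x i j :
  vecM a v F x i j = vec a v (fun y => F y i j) x.
Proof.
by rewrite /vecM /vec summxE; apply: eq_bigr => k _; rewrite !mxE.
Qed.

Lemma vecM_pdM (a : chart X) v (m l : nat) (F : pt X -> 'M[C]_(m, l)) x :
  vecM a v F x = \sum_(k < n) v 0 k *: pdM a (lshift n k) F x.
Proof. by []. Qed.

Opaque vecM.

Lemma vecDv (a : chart X) v w f x : vec a (v + w) f x = vec a v f x + vec a w f x.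
Proof.
by rewrite /vec -big_split; apply: eq_bigr => k _; rewrite mxE mulrDl.
Qed.

Lemma vecZv (a : chart X) (c : C) v f x : vec a (c *: v) f x = c * vec a v f x.
Proof. by rewrite /vec mulr_sumr; apply: eq_bigr => k _; rewrite mxE mulrA. Qed.

Lemma vecMDv (a : chart X) v w (m l : nat) (F : pt X -> 'M[C]_(m, l)) x :
  vecM a (v + w) F x = vecM a v F x + vecM a w F x.
Proof. by apply/matrixP => i j; rewrite !mxE !vecME vecDv. Qed.

Lemma vecMZv (a : chart X) (c : C) v (m l : nat) (F : pt X -> 'M[C]_(m, l)) x :
  vecM a (c *: v) F x = c *: vecM a v F x.
Proof. by apply/matrixP => i j; rewrite !mxE !vecME vecZv. Qed.

Section Local.
Context {a : chart X} {U : set (pt X)} (oU : open U) (Ua : U `<=` dom a).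

Lemma smooth_vec (v : pt X -> 'rV[C]_n) f : smoothM a U v -> smooth a U f ->
  smooth a U (fun x => vec a (v x) f x).
Proof.
move=> sv sf; apply: smooth_sum => // k _; apply: smoothMl => //.
exact: smooth_pd.
Qed.

Section AtPoint.
Context {x : pt X} (Ux : U x).

Lemma eq_vec v f g : (forall y, U y -> f y = g y) -> vec a v f x = vec a v g x.
Proof.
by move=> fg; apply: eq_bigr => k _; rewrite (eq_pd oU Ua _ fg Ux).
Qed.

Lemma vec_cst v (c : C) : vec a v (fun=> c) x = 0.
Proof. by apply: big1 => k _; rewrite pd_cst mulr0. Qed.

Lemma vecD v f g : smooth a U f -> smooth a U g ->
  vec a v (fun y => f y + g y) x = vec a v f x + vec a v g x.
Proof.
move=> sf sg; rewrite /vec -big_split; apply: eq_bigr => k _.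
by rewrite (pdD Ux _ sf sg) mulrDr.
Qed.

Lemma vecMl v f g : smooth a U f -> smooth a U g ->
  vec a v (fun y => f y * g y) x = vec a v f x * g x + f x * vec a v g x.
Proof.
move=> sf sg; rewrite /vec mulr_suml mulr_sumr -big_split; apply: eq_bigr => k _.
by rewrite (pdMl Ua Ux _ sf sg) mulrDr mulrA [f x * (_ * _)]mulrCA.
Qed.

Lemma vecN v f : smooth a U f -> vec a v (fun y => - f y) x = - vec a v f x.
Proof.
move=> sf; rewrite (eq_vec _ (fun y _ => esym (mulN1r (f y)))).
by rewrite (vecMl _ (smooth_cst _) sf) vec_cst mul0r add0r mulN1r.
Qed.

Lemma vec_sum v (I : Type) (s : seq I) (F : I -> pt X -> C) :
  (forall i, smooth a U (F i)) ->
  vec a v (fun y => \sum_(i <- s) F i y) x = \sum_(i <- s) vec a v (F i) x.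
Proof.
move=> sF; elim: s => [|i s IHs].
  by rewrite big_nil (eq_vec _ (fun y _ => big_nil _ _ _ _)) vec_cst.
rewrite big_cons (eq_vec _ (fun y _ => big_cons _ _ _ _ _ _)) -IHs.
by apply: vecD => //; apply: smooth_sum.
Qed.

(** By the product rule each composition splits into derivatives of the coefficients, which form the
    bracket, and a second-order part, which is symmetric in v and w because partial derivatives
    commute. *)
Lemma vec_bracket (v w : pt X -> 'rV[C]_n) f :
    smoothM a U v -> smoothM a U w -> smooth a U f ->
  vec a (v x) (fun y => vec a (w y) f y) x - vec a (w x) (fun y => vec a (v y) f y) x =
  vec a (vf_bracket a v w x) f x.
Proof.
move=> sv sw sf.
have sp k : smooth a U (pd a (lshift n k) f) by exact: smooth_pd.
have E (p q : pt X -> 'rV[C]_n) : smoothM a U q ->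
    vec a (p x) (fun y => vec a (q y) f y) x =
    \sum_(k < n) vec a (p x) (fun y => q y 0 k) x * pd a (lshift n k) f x +
    \sum_(k < n) \sum_(l < n) q x 0 k * (p x 0 l *
        pd a (lshift n l) (pd a (lshift n k) f) x).
  move=> sq; rewrite vec_sum; last by move=> k; apply: smoothMl.
  rewrite -big_split; apply: eq_bigr => k _ /=.
  by rewrite vecMl // [X in _ + _ * X]/vec mulr_sumr.
rewrite (E v w) // (E w v) //.
rewrite [X in _ - (_ + X)]exchange_big /=.
rewrite [X in _ - (_ + X)](_ : _ = \sum_(k < n) \sum_(l < n) w x 0 k * (v x 0 l *
        pd a (lshift n l) (pd a (lshift n k) f) x)); last first.
  apply: eq_bigr => k _; apply: eq_bigr => l _.
  by rewrite (pdC oU Ua Ux _ _ sf) mulrCA.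
have cancel (p q s : C) : p + q - (s + q) = p - s by rewrite opprD addrACA subrr addr0.
rewrite cancel -sumrB /vec; apply: eq_bigr => k _.
by rewrite mxE mulrBl.
Qed.

End AtPoint.

Section Matrices.
Context {m l : nat}.
Implicit Types F G : pt X -> 'M[C]_(m, l).

Lemma eq_smoothM F G : (forall x, U x -> F x = G x) -> smoothM a U F -> smoothM a U G.
Proof. by move=> FG sF i j; apply: (eq_smooth oU Ua _ (sF i j)) => x Ux; rewrite FG. Qed.

Lemma smoothM_cst (A : 'M[C]_(m, l)) : smoothM a U (fun=> A).
Proof. move=> i j; exact: smooth_cst. Qed.

Lemma smoothMD F G : smoothM a U F -> smoothM a U G -> smoothM a U (fun x => F x + G x).
Proof.
move=> sF sG i j; apply: (eq_smooth oU Ua _ (smoothD oU Ua (sF i j) (sG i j))) => x _.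
by rewrite mxE.
Qed.

Lemma smoothMN F : smoothM a U F -> smoothM a U (fun x => - F x).
Proof.
move=> sF i j; apply: (eq_smooth oU Ua _ (smoothN oU Ua (sF i j))) => x _.
by rewrite mxE.
Qed.

Lemma smoothMB F G : smoothM a U F -> smoothM a U G -> smoothM a U (fun x => F x - G x).
Proof. by move=> sF sG; apply: smoothMD => //; exact: smoothMN. Qed.

Lemma smoothMZ f F : smooth a U f -> smoothM a U F -> smoothM a U (fun x => f x *: F x).
Proof.
move=> sf sF i j; apply: (eq_smooth oU Ua _ (smoothMl oU Ua sf (sF i j))) => x _.
by rewrite mxE.
Qed.

Lemma smoothM_conj F : smoothM a U F -> smoothM a U (fun x => conjM (F x)).
Proof.
move=> sF i j; apply: (eq_smooth oU Ua _ (smoothJ oU Ua (sF i j))) => x _.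
by rewrite mxE.
Qed.

Lemma smoothM_vecM (v : pt X -> 'rV[C]_n) F : smoothM a U v -> smoothM a U F ->
  smoothM a U (fun x => vecM a (v x) F x).
Proof.
move=> sv sF i j; apply: (eq_smooth oU Ua _ (smooth_vec sv (sF i j))) => x _.
by rewrite vecME.
Qed.

Section AtPoint.
Context {x : pt X} (Ux : U x).

Lemma eq_vecM v F G : (forall y, U y -> F y = G y) -> vecM a v F x = vecM a v G x.
Proof.
move=> FG; apply/matrixP => i j; rewrite [LHS]vecME [RHS]vecME.
by apply: (eq_vec Ux) => y Uy; rewrite FG.
Qed.

Lemma vecM_cst v (A : 'M[C]_(m, l)) : vecM a v (fun=> A) x = 0.
Proof. by apply/matrixP => i j; rewrite vecME mxE vec_cst. Qed.

Lemma vecMD v F G : smoothM a U F -> smoothM a U G ->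
  vecM a v (fun y => F y + G y) x = vecM a v F x + vecM a v G x.
Proof.
move=> sF sG; apply/matrixP => i j.
rewrite [LHS]vecME mxE [X in _ = X + _]vecME [X in _ = _ + X]vecME.
rewrite -(vecD Ux v (sF i j) (sG i j)).
by apply: (eq_vec Ux) => y _; rewrite mxE.
Qed.

Lemma vecMN v F : smoothM a U F -> vecM a v (fun y => - F y) x = - vecM a v F x.
Proof.
move=> sF; apply/matrixP => i j; rewrite [LHS]vecME mxE [X in _ = - X]vecME.
rewrite -(vecN Ux v (sF i j)).
by apply: (eq_vec Ux) => y _; rewrite mxE.
Qed.

Lemma vecMB v F G : smoothM a U F -> smoothM a U G ->
  vecM a v (fun y => F y - G y) x = vecM a v F x - vecM a v G x.
Proof. by move=> sF sG; rewrite vecMD ?vecMN //; exact: smoothMN. Qed.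

Lemma vecMZ v f F : smooth a U f -> smoothM a U F ->
  vecM a v (fun y => f y *: F y) x = vec a v f x *: F x + f x *: vecM a v F x.
Proof.
move=> sf sF; apply/matrixP => i j; rewrite [LHS]vecME mxE [X in _ = X + _]mxE [X in _ = _ + X]mxE.
rewrite [X in _ = _ + _ * X]vecME -(vecMl Ux v sf (sF i j)).
by apply: (eq_vec Ux) => y _; rewrite mxE.
Qed.

Lemma vecMZ_cst v f (A : 'M[C]_(m, l)) : smooth a U f ->
  vecM a v (fun y => f y *: A) x = vec a v f x *: A.
Proof. by move=> sf; rewrite (vecMZ v sf (smoothM_cst A)) vecM_cst scaler0 addr0. Qed.

Lemma vecM_bracket (v w : pt X -> 'rV[C]_n) F :
    smoothM a U v -> smoothM a U w -> smoothM a U F ->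
  vecM a (v x) (fun y => vecM a (w y) F y) x - vecM a (w x) (fun y => vecM a (v y) F y) x =
  vecM a (vf_bracket a v w x) F x.
Proof.
move=> sv sw sF; apply/matrixP => i j.
have E (p q : pt X -> 'rV[C]_n) : vecM a (p x) (fun y => vecM a (q y) F y) x i j =
    vec a (p x) (fun y => vec a (q y) (fun z => F z i j) y) x.
  by rewrite [LHS]vecME; apply: (eq_vec Ux) => y _; rewrite vecME.
rewrite [RHS]vecME -(vec_bracket Ux sv sw (sF i j)) mxE [X in _ + X = _]mxE.
by rewrite [X in X - _ = _]E [X in _ - X = _]E.
Qed.

End AtPoint.
End Matrices.

Lemma smoothM_mul (m l p : nat) (F : pt X -> 'M[C]_(m, l)) (G : pt X -> 'M[C]_(l, p)) :
  smoothM a U F -> smoothM a U G -> smoothM a U (fun x => F x *m G x).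
Proof.
move=> sF sG i j.
apply: (eq_smooth oU Ua (f := fun x => \sum_k F x i k * G x k j)) => [x _|].
  by rewrite mxE.
by apply: smooth_sum => // k _; apply: smoothMl.
Qed.

Lemma vecM_mul (m l p : nat) (F : pt X -> 'M[C]_(m, l)) (G : pt X -> 'M[C]_(l, p)) v x :
    U x -> smoothM a U F -> smoothM a U G ->
  vecM a v (fun y => F y *m G y) x = vecM a v F x *m G x + F x *m vecM a v G x.
Proof.
move=> Ux sF sG; apply/matrixP => i j; rewrite [LHS]vecME mxE [X in _ = X + _]mxE [X in _ = _ + X]mxE.
rewrite (eq_vec Ux v (g := fun y => \sum_k F y i k * G y k j)); last first.
  by move=> y _; rewrite mxE.
rewrite (vec_sum Ux); last by move=> k; apply: smoothMl.
rewrite -big_split; apply: eq_bigr => k _ /=.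
by rewrite (vecMl Ux) // !vecME.
Qed.

Lemma smoothM_trmx (m l : nat) (F : pt X -> 'M[C]_(m, l)) :
  smoothM a U F -> smoothM a U (fun x => (F x)^T).
Proof. by move=> sF i j; apply: (eq_smooth oU Ua _ (sF j i)) => x _; rewrite mxE. Qed.

Lemma smooth_det (m : nat) (F : pt X -> 'M[C]_m) :
  smoothM a U F -> smooth a U (fun x => \det (F x)).
Proof.
move=> sF; apply: smooth_sum => // s _; apply: smoothMl => //; first exact: smooth_cst.
by apply: smooth_prod.
Qed.

(** Cramer's formula: the determinant and the cofactors are polynomial in the entries. *)
Lemma smoothM_inv (m : nat) (F : pt X -> 'M[C]_m) :
    (forall x, U x -> F x \in unitmx) -> smoothM a U F ->
  smoothM a U (fun x => invmx (F x)).
Proof.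
move=> uF sF; apply: (eq_smoothM (F := fun x => (\det (F x))^-1 *: \adj (F x))).
  by move=> x Ux; rewrite /invmx uF.
apply: smoothMZ.
  exact: smoothV (smooth_det sF).
move=> i j; apply: (eq_smooth oU Ua (f := fun x => cofactor (F x) j i)).
  by move=> x _; rewrite mxE.
apply: smoothMl => //; first exact: smooth_cst.
apply: smooth_det => s t.
by apply: (eq_smooth oU Ua _ (sF (lift j s) (lift i t))) => x _; rewrite !mxE.
Qed.

(** Differentiate F^-1 F = 1 and solve for the derivative of F^-1. *)
Lemma vecM_inv (m : nat) (F : pt X -> 'M[C]_m) v x : U x ->
    (forall x, U x -> F x \in unitmx) -> smoothM a U F ->
  vecM a v (fun y => invmx (F y)) x = - (invmx (F x) *m vecM a v F x *m invmx (F x)).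
Proof.
move=> Ux uF sF; have sV := smoothM_inv uF sF.
have := vecM_mul v Ux sV sF.
rewrite (eq_vecM Ux v (G := fun=> 1%:M)) => [|y Uy]; last by rewrite mulVmx ?uF.
rewrite vecM_cst => /esym/eqP; rewrite addr_eq0 => /eqP E.
by rewrite -mulNmx -E mulmxK ?uF.
Qed.

End Local.

Section Overlap.
Context {a b : chart X} {U : set (pt X)}.
Context (oU : open U) (Ua : U `<=` dom a) (Ub : U `<=` dom b).

Lemma smoothM_change (m l : nat) (F : pt X -> 'M[C]_(m, l)) :
  smoothM a U F -> smoothM b U F.
Proof. by move=> sF i j; exact: (smooth_change oU Ua Ub (sF i j)). Qed.

(** The hypothesis on w says that w and v are the components, in the charts a and b, of the same
    tangent vector. *)
Lemma vec_change (v w : 'rV[C]_n) f x : U x ->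
    (forall k, w 0 k = vec b v (zeta a (lshift n k)) x) -> smooth a U f ->
  vec a w f x = vec b v f x.
Proof.
move=> Ux wv sf; rewrite /vec.
under [RHS]eq_bigr do rewrite (pd_change oU Ua Ub _ sf Ux) mulr_sumr.
rewrite exchange_big; apply: eq_bigr => k _ /=; rewrite wv mulr_suml.
by apply: eq_bigr => j _; rewrite -mulrA [pd a _ _ _ * _]mulrC.
Qed.

Lemma vecM_change (v w : 'rV[C]_n) (m l : nat) (F : pt X -> 'M[C]_(m, l)) x : U x ->
    (forall k, w 0 k = vec b v (zeta a (lshift n k)) x) -> smoothM a U F ->
  vecM a w F x = vecM b v F x.
Proof.
by move=> Ux wv sF; apply/matrixP => i j; rewrite [LHS]vecME [RHS]vecME; apply: vec_change.
Qed.

End Overlap.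

Lemma vec_zeta (a : chart X) v (k : 'I_n) x : dom a x ->
  vec a v (zeta a (lshift n k)) x = v 0 k.
Proof.
move=> ax; rewrite /vec (bigD1 k) //= pd_zeta // eqxx mulr1 big1 ?addr0 // => l lk.
by rewrite pd_zeta // eq_sym (negbTE lk) mulr0.
Qed.

End MatrixCalculus.

(** * Sections of D^1(E) and the isomorphism with A(E) *)

Section Bundle.
Context {R : realType} {n r : nat} {X : complexManifold R n} {E : holBundle X r}.
Local Notation C := R[i].
Local Notation fib := ('M[C]_r * 'rV[C]_n)%type.
Implicit Types (a b : chart X) (x : pt X).

Let oab a b : open (dom a `&` dom b).
Proof. by apply: openI; exact: dom_open. Qed.

Lemma trans_unit a b x : dom a x -> dom b x -> trans E a b x \in unitmx.
Proof.
move=> ax bx; have /mulmx1_unit[] // : trans E a b x *m trans E b a x = 1%:M.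
by rewrite trans_cocycle // trans_id.
Qed.

Lemma act_eq a (P : pt X -> fib) (s s' : pt X -> 'cV[C]_r) (U : set (pt X)) x :
    open U -> U `<=` dom a -> U x -> (forall y, U y -> s y = s' y) ->
  act a P s x = act a P s' x.
Proof.
by move=> oU Ua Ux ss; rewrite /act (ss x Ux) (eq_vecM oU Ua Ux _ ss).
Qed.

Lemma act_smooth a (P : pt X -> fib) (s : pt X -> 'cV[C]_r) (U : set (pt X)) :
    open U -> U `<=` dom a ->
    smoothM a U (fun x => (P x).1) -> smoothM a U (fun x => (P x).2) ->
    smoothM a U s ->
  smoothM a U (act a P s).
Proof.
move=> oU Ua s1 s2 ss; apply: smoothMD => //; first exact: smoothM_mul.
exact: smoothM_vecM.
Qed.

(** The derivative of the transition matrix is the defect that keeps the zeroth-order part of an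
    operator from transforming like an endomorphism. *)
Lemma act_trans a b (P : pt X -> fib) (s : pt X -> 'cV[C]_r) x :
    dom a x -> dom b x -> smoothM b (dom a `&` dom b) s ->
  act a P (fun y => trans E a b y *m s y) x =
  ((P x).1 *m trans E a b x + vecM a (P x).2 (trans E a b) x) *m s x +
  trans E a b x *m vecM a (P x).2 s x.
Proof.
move=> ax bx ss; have ss' : smoothM a (dom a `&` dom b) s.
  exact: (smoothM_change (oab a b) (@subIsetr _ _ _) (@subIsetl _ _ _)).
rewrite /act (vecM_mul (oab a b) (@subIsetl _ _ _)) //.
  by rewrite mulmxA mulmxDl addrA.
by have [] := trans_holomorphic E a b.
Qed.

(** Trades the quantification over sections of E for pointwise laws on the coefficients: the symbol
    is a vector field, and the matrix part has an inhomogeneous law. *)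
Lemma D1_sectionP (P : lsec X (r := r)) : (0 < r)%N ->
  D1_section E P <-> smooth_fib P /\
  forall a b x, dom a x -> dom b x ->
    (forall k : 'I_n, (P a x).2 0 k = vec b (P b x).2 (zeta a (lshift n k)) x) /\
    (P a x).1 *m trans E a b x + vecM a (P a x).2 (trans E a b) x =
    trans E a b x *m (P b x).1.
Proof.
move=> r0; split=> -[sP DP]; split=> // a b.
  move=> x ax bx.
  have Uab : (dom a `&` dom b) x by [].
  have M : (P a x).1 *m trans E a b x + vecM a (P a x).2 (trans E a b) x =
      trans E a b x *m (P b x).1.
    apply/matrixP => i j; pose s : pt X -> 'cV[C]_r := fun=> delta_mx j 0.
    have sC : smoothM b (dom a `&` dom b) s by exact: smoothM_cst.
    have := DP a b s sC x ax bx; rewrite act_trans // /act !vecM_cst.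
    by rewrite mulmx0 !addr0 mulmxA -!colE => /colP/(_ i); rewrite !mxE.
  split=> // k.
  pose i0 : 'I_r := Ordinal r0.
  pose s : pt X -> 'cV[C]_r := fun y => zeta a (lshift n k) y *: delta_mx i0 0.
  have sz : smooth b (dom a `&` dom b) (zeta a (lshift n k)).
    exact: smooth_zeta (oab a b) (@subIsetl _ _ _) (@subIsetr _ _ _) _.
  have sa : smooth a (dom a `&` dom b) (zeta a (lshift n k)).
    exact: smooth_zeta (oab a b) (@subIsetl _ _ _) (@subIsetl _ _ _) _.
  have ss : smoothM b (dom a `&` dom b) s.
    by apply: (smoothMZ (oab a b) (@subIsetr _ _ _) sz); exact: smoothM_cst.
  (* The matrix law M cancels the zeroth-order terms, and the invertible transition matrix can then
     be removed; what is left compares the derivatives of z^k along the two symbols. *)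
  have := DP a b s ss x ax bx; rewrite act_trans // M /act mulmxDr mulmxA.
  move=> /addrI /(can_inj (mulKmx (trans_unit ax bx))) /matrixP/(_ i0 0).
  rewrite (vecMZ_cst (oab a b) (@subIsetl _ _ _) Uab _ _ sa).
  rewrite (vecMZ_cst (oab a b) (@subIsetr _ _ _) Uab _ _ sz).
  have de (c : C) : (c *: delta_mx i0 0 : 'cV[C]_r) i0 0 = c.
    by rewrite !mxE !eqxx mulr1.
  by rewrite [in LHS]de [in RHS]de vec_zeta.
move=> s ss x ax bx; have [vP M] := DP a b x ax bx.
have Uab : (dom a `&` dom b) x by [].
have -> := act_trans (P a) ax bx ss.
have sa := smoothM_change (oab a b) (@subIsetr _ _ _) (@subIsetl _ _ _) ss.
have Es := vecM_change (oab a b) (@subIsetl _ _ _) (@subIsetr _ _ _) Uab vP sa.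
by rewrite M Es /act mulmxDr mulmxA.
Qed.

End Bundle.

(** * The Chern connection matrix, its gauge law and the isomorphism *)

Section ChernConnection.
Context {R : realType} {n r : nat} {X : complexManifold R n} {E : holBundle X r}.
Variable h : hermMetric E.
Local Notation C := R[i].
Implicit Types (a b : chart X) (x : pt X) (v w : 'rV[C]_n).

Definition hbar a x : 'M[C]_r := conjM (herm h a x).

(* The contraction of the Chern connection matrix with v. *)
Definition theta a v x : 'M[C]_r := invmx (hbar a x) *m vecM a v (hbar a) x.

Let oab a b : open (dom a `&` dom b).
Proof. by apply: openI; exact: dom_open. Qed.

Lemma conjMK (m l : nat) (F : 'M[C]_(m, l)) : conjM (conjM F) = F.
Proof. by apply/matrixP => i j; rewrite !mxE conjCK. Qed.

Lemma conjM_mul (m l p : nat) (F : 'M[C]_(m, l)) (G : 'M[C]_(l, p)) :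
  conjM (F *m G) = conjM F *m conjM G.
Proof. exact: map_mxM. Qed.

(** A nonzero row in the kernel would, once transposed, be a nonzero vector of norm zero. *)
Lemma herm_unit a x : dom a x -> herm h a x \in unitmx.
Proof.
move=> ax; rewrite -row_free_unit -kermx_eq0; apply/negPn/negP => /rowV0Pn[u].
move=> /sub_kermxP uh u0; have v0 : u^T != 0 by rewrite trmx_eq0.
by have := herm_positive h ax v0; rewrite trmxK uh mul0mx mxE ltxx.
Qed.

Lemma hbar_unit a x : dom a x -> hbar a x \in unitmx.
Proof. by move=> ax; rewrite map_unitmx herm_unit. Qed.

Lemma hbar_smooth a : smoothM a (dom a) (hbar a).
Proof. exact: (smoothM_conj (dom_open a) (@subset_refl _ _) (herm_smooth h a)). Qed.

Lemma smooth_theta a (v : pt X -> 'rV[C]_n) : smoothM a (dom a) v ->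
  smoothM a (dom a) (fun x => theta a (v x) x).
Proof.
move=> sv; have da := dom_open a; apply: smoothM_mul => //.
  by apply: smoothM_inv => //; [exact: hbar_unit|exact: hbar_smooth].
by apply: smoothM_vecM => //; exact: hbar_smooth.
Qed.

Lemma thetaD a v w x : theta a (v + w) x = theta a v x + theta a w x.
Proof. by rewrite /theta vecMDv mulmxDr. Qed.

Lemma thetaZ a (c : C) v x : theta a (c *: v) x = c *: theta a v x.
Proof. by rewrite /theta vecMZv -scalemxAr. Qed.

(** Conjugation exchanges d/dz^k and d/dzbar^k, and the latter kills F. *)
Lemma vecM_conj_hol a (U : set (pt X)) (m l : nat) (F : pt X -> 'M[C]_(m, l)) v x :
    open U -> U `<=` dom a -> U x -> holomorphicM a U F ->
  vecM a v (fun y => (conjM (F y))^T) x = 0.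
Proof.
move=> oU Ua Ux [sF hF]; apply/matrixP => i j; rewrite vecME [RHS]mxE.
apply: big1 => k _.
have -> : pd a (lshift n k) (fun y => (conjM (F y))^T i j) x =
    pd a (lshift n k) (fun y => (F y j i)^*%C) x.
  by apply: (eq_pd oU Ua) => // y _; rewrite !mxE.
rewrite (pdJ Ux k (sF j i)).
have /matrixP/(_ j i) := hF k x Ux; rewrite !mxE => ->.
by rewrite conjc0 mulr0.
Qed.

(* The gauge transformation law of the connection matrix. *)
Lemma theta_change a b v w x : dom a x -> dom b x ->
    (forall k, w 0 k = vec b v (zeta a (lshift n k)) x) ->
  trans E a b x *m theta b v x =
  theta a w x *m trans E a b x + vecM a w (trans E a b) x.
Proof.
move=> ax bx wv; have Uab : (dom a `&` dom b) x by [].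
pose t := trans E a b; pose tS y := (conjM (t y))^T.
have oU := oab a b; have Ua := @subIsetl _ (dom a) (dom b).
have Ub := @subIsetr _ (dom a) (dom b).
have tH := trans_holomorphic E a b.
have st : smoothM a (dom a `&` dom b) t by case: tH.
have stS : smoothM a (dom a `&` dom b) tS.
  by apply: smoothM_trmx => //; apply: smoothM_conj.
have sha : smoothM a (dom a `&` dom b) (hbar a).
  by move=> i j; exact: sub_smooth Ua (hbar_smooth a i j).
have hbE y : (dom a `&` dom b) y -> hbar b y = tS y *m (hbar a y *m t y).
  move=> [ay by_]; rewrite /hbar (herm_trans h ay by_) !conjM_mul conjMK mulmxA.
  by congr (_ *m _ *m _); rewrite /conjM -matrix.map_trmx.
have shat : smoothM a (dom a `&` dom b) (fun y => hbar a y *m t y).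
  exact: smoothM_mul.
have shb : smoothM a (dom a `&` dom b) (hbar b).
  by apply: (eq_smoothM oU Ua (fun y Uy => esym (hbE y Uy))); exact: smoothM_mul.
have dE : vecM b v (hbar b) x =
    tS x *m (vecM a w (hbar a) x *m t x + hbar a x *m vecM a w t x).
  rewrite -(vecM_change oU Ua Ub Uab wv shb) (eq_vecM oU Ua Uab _ hbE).
  rewrite (vecM_mul oU Ua _ Uab stS shat) (vecM_conj_hol _ oU Ua Uab tH).
  by rewrite mul0mx add0r (vecM_mul oU Ua _ Uab sha st).
have tu : t x \in unitmx by exact: trans_unit.
have hu := hbar_unit ax.
rewrite /theta dE; set A := vecM a w (hbar a) x; set B := vecM a w t x.
(* Factoring out [hbar b x] on the left cancels the inverse in [theta]; the remaining [invmx (t x)]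
   cancels against the transition matrix of the claim. *)
have -> : tS x *m (A *m t x + hbar a x *m B) =
    hbar b x *m (invmx (t x) *m (invmx (hbar a x) *m A *m t x + B)).
  by rewrite hbE // -!mulmxA mulKVmx // [hbar a x *m (_ + _)]mulmxDr mulKVmx.
by rewrite mulKmx ?hbar_unit // mulKVmx.
Qed.

Lemma PhiE a x (P : 'M[C]_r * 'rV[C]_n) : Phi h a x P = (P.1 - theta a P.2 x, P.2).
Proof. by []. Qed.

Lemma smooth_fib_Phi (P : lsec X) : smooth_fib (Phi_sec h P) <-> smooth_fib P.
Proof.
have st (Q : lsec X (r := r)) a : smoothM a (dom a) (fun x => (Q a x).2) ->
    smoothM a (dom a) (fun x => theta a (Q a x).2 x) by exact: smooth_theta.
split=> sP a; have [s1 s2] := sP a; split=> //; have da := dom_open a.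
  have s3 := smoothMD da (@subset_refl _ _) s1 (st P a s2).
  apply: (eq_smoothM da (@subset_refl _ _) _ s3) => x _.
  by rewrite /= subrK.
exact: (smoothMB da (@subset_refl _ _) s1 (st P a s2)).
Qed.

Lemma Phi_is_isomorphism : (0 < r)%N -> Phi_isomorphism h.
Proof.
move=> r0; split=> [a x ax|P].
  split=> [c u w|]; first rewrite !PhiE thetaD thetaZ.
    congr (_, _); rewrite /= scalerBr opprD addrACA //.
  exists (fun Q => (Q.1 + theta a Q.2 x, Q.2)) => -[g v].
    by rewrite PhiE /= subrK.
  by rewrite PhiE /= addrK.
(* Both kinds of sections have the same law for the vector part; once it holds, the gauge law makes
   the two zeroth-order laws equivalent. *)
have key a b x : dom a x -> dom b x ->
    (forall k : 'I_n, (P a x).2 0 k = vec b (P b x).2 (zeta a (lshift n k)) x) ->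
    (Phi_sec h P a x).1 *m trans E a b x = trans E a b x *m (Phi_sec h P b x).1 <->
    (P a x).1 *m trans E a b x + vecM a (P a x).2 (trans E a b) x =
      trans E a b x *m (P b x).1.
  move=> ax bx vP; rewrite /Phi_sec !PhiE mulmxBl mulmxBr (theta_change ax bx vP).
  have alg (p q s d : 'M[C]_r) : p - q = s - (q + d) <-> p + d = s.
    by rewrite opprD [- q - d]addrC addrA; split=> [/addIr->|<-]; rewrite ?subrK ?addrK.
  exact: alg.
split.
  move=> /(D1_sectionP _ r0)[sP DP]; split; first exact/smooth_fib_Phi.
  by move=> a b x ax bx; have [vP /key M] := DP a b x ax bx; split=> //; exact: M.
move=> [/smooth_fib_Phi sP AP]; apply/(D1_sectionP _ r0); split=> // a b x ax bx.
by have [M vP] := AP a b x ax bx; split=> //; apply/key.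
Qed.

End ChernConnection.

(** * The commutator of two sections of D^1(E) *)

Section Commutator.
Context {R : realType} {n r : nat} {X : complexManifold R n} {E : holBundle X r}.
Local Notation C := R[i].
Local Notation fib := ('M[C]_r * 'rV[C]_n)%type.
Implicit Types (a b : chart X) (x : pt X) (P S : lsec X (r := r)).

Let oab a b : open (dom a `&` dom b).
Proof. by apply: openI; exact: dom_open. Qed.

(** The coefficients obtained by expanding the commutator of g_P + v and g_S + u. Scalar symbols
    commute, so nothing of second order survives. *)
Definition local_commutator P S : lsec X (r := r) := fun a x =>
  ((P a x).1 *m (S a x).1 - (S a x).1 *m (P a x).1
   + (vecM a (P a x).2 (fun y => (S a y).1) x - vecM a (S a x).2 (fun y => (P a y).1) x),
   vf_bracket a (fun y => (P a y).2) (fun y => (S a y).2) x).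

Lemma smooth_vf_bracket a (v w : pt X -> 'rV[C]_n) :
  smoothM a (dom a) v -> smoothM a (dom a) w -> smoothM a (dom a) (vf_bracket a v w).
Proof.
move=> sv sw i k; have da := dom_open a.
have s1 := smooth_vec da (@subset_refl _ _) sv (sw 0 k).
have s2 := smooth_vec da (@subset_refl _ _) sw (sv 0 k).
apply: (eq_smooth da (@subset_refl _ _) _ (smoothB da (@subset_refl _ _) s1 s2)).
by move=> x _; rewrite mxE.
Qed.

Lemma local_commutator_smooth P S :
  smooth_fib P -> smooth_fib S -> smooth_fib (local_commutator P S).
Proof.
move=> sP sS a; have [p1 p2] := sP a; have [s1 s2] := sS a; have da := dom_open a.
split; last exact: smooth_vf_bracket.
apply: smoothMD => //.
  by apply: smoothMB => //; apply: smoothM_mul.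
by apply: smoothMB => //; apply: smoothM_vecM.
Qed.

(** The mixed terms g_P u(s) and g_S v(s) occur in both compositions and cancel. A general U is
    allowed because sections compared across two charts are smooth only on the overlap. *)
Lemma act_local_commutator P S a (U : set (pt X)) (s : pt X -> 'cV[C]_r) x :
    smooth_fib P -> smooth_fib S -> open U -> U `<=` dom a -> U x ->
    smoothM a U s ->
  act a (local_commutator P S a) s x =
  act a (P a) (act a (S a) s) x - act a (S a) (act a (P a) s) x.
Proof.
move=> sP sS oU Ua Ux ss.
have sub (m l : nat) (F : pt X -> 'M[C]_(m, l)) : smoothM a (dom a) F -> smoothM a U F.
  by move=> sF i j; exact: sub_smooth Ua (sF i j).
have [/sub p1 /sub p2] := sP a; have [/sub s1 /sub s2] := sS a.
have D (Q T : pt X -> fib) : smoothM a U (fun y => (T y).1) ->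
    smoothM a U (fun y => (T y).2) ->
    act a Q (act a T s) x =
    (Q x).1 *m ((T x).1 *m s x) + (Q x).1 *m vecM a (T x).2 s x +
    (vecM a (Q x).2 (fun y => (T y).1) x *m s x + (T x).1 *m vecM a (Q x).2 s x +
     vecM a (Q x).2 (fun y => vecM a (T y).2 s y) x).
  move=> t1 t2; rewrite {1}/act [act a T s x]/act mulmxDr; congr (_ + _).
  have st1 := smoothM_mul oU Ua t1 ss; have st2 := smoothM_vecM oU Ua t2 ss.
  by rewrite -(vecM_mul oU Ua _ Ux t1 ss) -(vecMD oU Ua Ux _ st1 st2).
rewrite (D (P a) (S a)) // (D (S a) (P a)) //.
rewrite /act /local_commutator /= -(vecM_bracket oU Ua Ux p2 s2 ss).
rewrite !(mulmxDl, mulNmx) -!mulmxA.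
have alg (A : zmodType) (t1 t2 t3 t4 t5 t6 p q : A) :
  t1 - t2 + (t3 - t4) + (t5 - t6) =
  t1 + p + (t3 + q + t5) - (t2 + q + (t4 + p + t6)).
  have -> : t1 + p + (t3 + q + t5) = t1 + (t3 + t5) + (p + q).
    by rewrite (AC (2*3) ((1*(3*5))*(2*4))).
  have -> : t2 + q + (t4 + p + t6) = t2 + (t4 + t6) + (p + q).
    by rewrite (AC (2*3) ((1*(3*5))*(4*2))).
  rewrite opprD [RHS]addrACA subrr addr0 opprD [RHS]addrACA opprD.
  by rewrite [X in _ = _ + X]addrACA [RHS]addrA.
exact: alg.
Qed.

(** Each operator is compatible with the transition matrices, hence so are both compositions; the
    transformation law of the coefficients is never computed. *)
Lemma D1_section_local_commutator P S : (0 < r)%N ->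
  D1_section E P -> D1_section E S -> D1_section E (local_commutator P S).
Proof.
move=> r0 [sP DP] [sS DS]; split; first exact: local_commutator_smooth.
move=> a b s ss x ax bx; have Uab : (dom a `&` dom b) x by [].
have oU := oab a b; have Ua := @subIsetl _ (dom a) (dom b).
have Ub := @subIsetr _ (dom a) (dom b).
have [st _] := trans_holomorphic E a b.
have sa := smoothM_change oU Ub Ua ss.
have sub c (cU : dom a `&` dom b `<=` dom c) (m l : nat) (F : pt X -> 'M[C]_(m, l)) :
    smoothM c (dom c) F -> smoothM c (dom a `&` dom b) F.
  by move=> sF i j; exact: sub_smooth cU (sF i j).
rewrite (act_local_commutator sP sS oU Ua Uab (smoothM_mul oU Ua st sa)).
rewrite (act_local_commutator sP sS oU Ub Uab ss) mulmxBr.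
have D (Q T : lsec X (r := r)) : D1_section E Q -> D1_section E T ->
    act a (Q a) (act a (T a) (fun y => trans E a b y *m s y)) x =
    trans E a b x *m act b (Q b) (act b (T b) s) x.
  move=> [sQ DQ] [sT DT].
  (* The law for T is needed on the whole overlap, since Q differentiates the result. *)
  rewrite (act_eq _ oU Ua Uab (s' := fun y => trans E a b y *m act b (T b) s y)).
    rewrite (DQ a b) //; apply: act_smooth => //; apply: sub => //;
      by have [] := sT b.
  by move=> y [ay by_]; exact: DT.
by rewrite (D P S) ?(D S P).
Qed.

(** This uniqueness identifies the chosen [commutator] with the explicit formula. *)
Lemma act_inj a x (P S : pt X -> fib) : (0 < r)%N -> dom a x ->
  (forall s, smoothM a (dom a) s -> act a P s x = act a S s x) -> P x = S x.
Proof.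
move=> r0 ax PS; have da := dom_open a.
have M : (P x).1 = (S x).1.
  apply/matrixP => i j; pose s : pt X -> 'cV[C]_r := fun=> delta_mx j 0.
  have := PS s (smoothM_cst _); rewrite /act !vecM_cst !addr0 -!colE.
  by move=> /colP/(_ i); rewrite !mxE.
apply/injective_projections => //; apply/rowP => k.
pose i0 : 'I_r := Ordinal r0.
pose s : pt X -> 'cV[C]_r := fun y => zeta a (lshift n k) y *: delta_mx i0 0.
have sz : smooth a (dom a) (zeta a (lshift n k)).
  exact: (smooth_zeta da (@subset_refl _ _) (@subset_refl _ _)).
have ss : smoothM a (dom a) s.
  by apply: (smoothMZ da (@subset_refl _ _) sz); exact: smoothM_cst.
have := PS s ss; rewrite /act M => /addrI.
rewrite !(vecMZ_cst da (@subset_refl _ _) ax _ _ sz) => /matrixP/(_ i0 0).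
have de (c : C) : (c *: delta_mx i0 0 : 'cV[C]_r) i0 0 = c.
  by rewrite !mxE !eqxx mulr1.
rewrite [in LHS]de [in RHS]de.
by rewrite !vec_zeta.
Qed.

Lemma commutatorE P S a x : (0 < r)%N -> D1_section E P -> D1_section E S ->
  dom a x -> commutator E P S a x = local_commutator P S a x.
Proof.
move=> r0 DP DS ax.
have [sP _] := DP; have [sS _] := DS.
have comm : is_commutator P S (local_commutator P S).
  move=> c s ss y cy.
  exact: (act_local_commutator sP sS (dom_open c) (@subset_refl _ _) cy ss).
(* [local_commutator P S] inhabits the set, so [xget] returns a member of it and not the default
   zero section. *)
have [_ cC] : [set Q | D1_section E Q /\ is_commutator P S Q] (commutator E P S).
  apply: xgetPex; exists (local_commutator P S); split=> //.
  exact: D1_section_local_commutator.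
by apply: (act_inj r0 ax) => s ss; rewrite cC // comm.
Qed.

End Commutator.

(** * Flatness of the Chern connection in the (1,0) directions *)

Section Curvature.
Context {R : realType} {n r : nat} {X : complexManifold R n} {E : holBundle X r}.
Variable h : hermMetric E.
Local Notation C := R[i].

(* The (2,0)-part of the curvature of the Chern connection vanishes. *)
Lemma theta_flat (a : chart X) (v w : pt X -> 'rV[C]_n) (x : pt X) : dom a x ->
    smoothM a (dom a) v -> smoothM a (dom a) w ->
  vecM a (v x) (fun y => theta h a (w y) y) x - vecM a (w x) (fun y => theta h a (v y) y) x =
  theta h a (vf_bracket a v w x) x -
  (theta h a (v x) x *m theta h a (w x) x - theta h a (w x) x *m theta h a (v x) x).
Proof.
move=> ax sv sw; have da := dom_open a; have sub := @subset_refl _ (dom a).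
have sH := hbar_smooth h a; have uH := @hbar_unit _ _ _ _ _ h a.
have sHV := smoothM_inv da sub uH sH.
(* The derivative of the inverse of [hbar] produces the product of two [theta]; the second
   derivatives of [hbar], once antisymmetrised, produce [theta] of the bracket. *)
have D (p q : pt X -> 'rV[C]_n) : smoothM a (dom a) q ->
    vecM a (p x) (fun y => theta h a (q y) y) x =
    - (theta h a (p x) x *m theta h a (q x) x) +
    invmx (hbar h a x) *m vecM a (p x) (fun y => vecM a (q y) (hbar h a) y) x.
  move=> sq; have sqH := smoothM_vecM da sub sq sH.
  rewrite /theta (vecM_mul da sub _ ax sHV sqH) (vecM_inv da sub _ ax uH sH).
  by rewrite mulNmx !mulmxA.
rewrite (D v w sw) (D w v sv) [theta h a (vf_bracket _ _ _ _) x]/theta.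
rewrite -(vecM_bracket da sub ax sv sw sH) mulmxBr.
have alg (A : zmodType) (p q s t : A) : - p + s - (- q + t) = s - t - (p - q).
  by rewrite opprB opprD opprK [RHS]addrC addrACA [q - p]addrC addrACA.
exact: alg.
Qed.

End Curvature.

(** * Brackets of forms *)

Lemma mulrz_sign (K : pzRingType) (V : lmodType K) (v : V) (m : nat) :
  v *~ (-1) ^+ m = (-1) ^+ m *: v.
Proof.
rewrite -signr_odd -[in RHS]signr_odd; case: (odd m).
  by rewrite !expr1 mulrN1z scaleN1r.
by rewrite !expr0 mulr1z scale1r.
Qed.

Lemma sign_mul_id (K : pzRingType) (V : lmodType K) (v : V) (m : nat) :
  v *~ (-1) ^+ m *~ (-1) ^+ m = v.
Proof. by rewrite -mulrzA -exprD addnn -signr_odd odd_double mulr1z. Qed.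

(** * Signs and graded commutativity of the wedge product *)

Section Wedge.
Context {R : realType} {n : nat} {X : complexManifold R n}.
Local Notation C := R[i].
Local Notation idx := {set 'I_(n + n)}.
Implicit Types (x : pt X) (I J K : idx) (w e : lform X C).

Lemma lshift_notin_bars (k : 'I_n) : lshift n k \notin bars (n := n).
Proof. by apply/imsetP => -[l _ /eqP]; rewrite eq_lrshift. Qed.

(** Each pair in I x J is an inversion for exactly one of the two orders; disjointness excludes
    ties. *)
Lemma ninvD I J : [disjoint I & J]%B -> (ninv I J + ninv J I = #|I| * #|J|)%N.
Proof.
move=> dIJ; pose B := [set ij : 'I_(n + n) * 'I_(n + n) | (ij.2 < ij.1)%N]%SET.
pose swap (ij : 'I_(n + n) * 'I_(n + n)) := (ij.2, ij.1).
have swapI : injective swap by move=> [i j] [i' j'] [-> ->].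
rewrite -cardsX -(cardsID B) /ninv; congr (_ + _)%N.
  by apply: eq_card => -[i j]; rewrite !inE /= andbA.
rewrite -(card_imset _ swapI); apply: eq_card => -[i j].
rewrite [RHS]inE [in RHS]inE [in X in _ = _ && X]inE /=.
apply/imsetP/idP => [[[j' i'] + [-> ->]]|].
  rewrite inE /= => /and3P[jJ iI ij].
  by rewrite iI jJ !andbT -leqNgt ltnW.
rewrite -leqNgt => /and3P[ij iI jJ]; exists (j, i) => //.
rewrite inE /= iI jJ ltn_neqAle ij andbT; apply/eqP => /ord_inj eij.
by move: dIJ => /disjointFr/(_ iI); rewrite eij jJ.
Qed.

(** Complementation inside K exchanges the two factors. Only terms with |I| = q and |K :\: I| = p
    survive, and there [ninvD] compares the two signs. *)
Lemma wedgeC p q w e K x :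
    (forall J, #|J| != p -> w J x = 0) -> (forall J, #|J| != q -> e J x = 0) ->
  wedge w e K x = (-1) ^+ (p * q) * wedge e w K x.
Proof.
move=> wp eq; rewrite /wedge /wedge_op mulr_sumr.
rewrite (reindex_onto (fun I => K :\: I) (fun I => K :\: I)); last first.
  by move=> I IK; rewrite finset.setDDr finset.setDv finset.set0U; apply/finset.setIidPr.
apply: eq_big => [I|I /andP[_ /eqP IK]].
  rewrite finset.subsetDl /= finset.setDDr finset.setDv finset.set0U.
  by apply/eqP/idP => [<-|/finset.setIidPr //]; exact: finset.subsetIl.
rewrite IK.
have [qI|/eqP qI] := eqVneq #|I| q; last first.
  by rewrite (eq I) ?mul0r ?mulr0 ?mul0rz ?mulr0 //; apply/eqP.
have [pI|/eqP pI] := eqVneq #|K :\: I| p; last first.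
  by rewrite (wp (K :\: I)) ?mul0r ?mulr0 ?mul0rz ?mulr0 //; apply/eqP.
have : [disjoint K :\: I & I]%B.
  by rewrite -finset.setI_eq0; apply/eqP/setP => i; rewrite !inE; case: (i \in I); rewrite ?andbF.
move=> /ninvD; rewrite pI qI => <-.
rewrite !(mulrz_sign (V := C^o)) /GRing.scale /=.
move: (ninv _ I) (ninv I _) (w _ x) (e _ x) => s t u v.
rewrite exprD -mulrA [(-1) ^+ t * _]mulrA -exprD addnn -[(-1) ^+ t.*2]signr_odd.
by rewrite odd_double expr0 mul1r [u * v]mulrC.
Qed.

Lemma sum_wedgeZ (V : lmodType C) (w : lform X C) (e : lform X C) (M : V) K x :
  \sum_(I : idx | I \subset K)
    ((w I x * e (K :\: I) x) *: M) *~ (-1) ^+ ninv I (K :\: I) =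
  wedge w e K x *: M.
Proof.
rewrite /wedge /wedge_op scaler_suml; apply: eq_bigr => I _.
by rewrite mulrz_sign (mulrz_sign (V := C^o)) scalerA.
Qed.

End Wedge.

(** * Lie derivative and covariant derivative of (0,q)-forms *)

Section LocalForms.
Context {R : realType} {n r : nat} {X : complexManifold R n} {E : holBundle X r}.
Variable h : hermMetric E.
Context {a : chart X} {x : pt X} (ax : dom a x).
Local Notation C := R[i].
Local Notation idx := {set 'I_(n + n)}.
Local Notation sub := (@subset_refl _ (dom a)).
Implicit Types (I J K : idx).

(* No dz^k occurs in w, so that w is a sum of forms of type (0, q). *)
Definition antiholomorphic (V : zmodType) (w : lform X V) : Prop :=
  forall k J y, dom a y -> lshift n k \in J -> w J y = 0.

Lemma lshift_in_setD (k : 'I_n) (i : 'I_(n + n)) K :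
  i != lshift n k -> lshift n k \in (lshift n k |: K) :\ i.
Proof. by move=> ik; rewrite !inE eq_sym ik eqxx. Qed.

Lemma pd_antiholomorphic (i : 'I_(n + n)) (k : 'I_n) (e : lform X C) J :
  antiholomorphic e -> lshift n k \in J -> pd a i (e J) x = 0.
Proof.
move=> e0 kJ; have -> : pd a i (e J) x = pd a i (fun=> 0) x.
  by apply: (eq_pd (dom_open a) sub) => // y ay; exact: e0 ay kJ.
exact: pd_cst.
Qed.

Lemma pdM_antiholomorphic (i : 'I_(n + n)) (k : 'I_n) (m : nat) (B : lform X 'M[C]_m) J :
  antiholomorphic B -> lshift n k \in J -> pdM a i (B J) x = 0.
Proof.
move=> B0 kJ; apply/matrixP => s t; rewrite !mxE.
have -> : pd a i (fun y => B J y s t) x = pd a i (fun=> 0) x.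
  by apply: (eq_pd (dom_open a) sub) => // y ay; rewrite (B0 k) // mxE.
exact: pd_cst.
Qed.

(** Every dz in [del a e] comes from the differentiation, so contraction with d/dz^k keeps exactly
    the k-th derivative; the sign of inserting dz^k and that of removing it coincide. *)
Lemma lie_antiholomorphic (v : pt X -> 'rV[C]_n) (e : lform X C) K :
  antiholomorphic e -> lie a v e K x = vec a (v x) (e K) x.
Proof.
move=> e0; rewrite /lie /vcontr /vec; apply: eq_bigr => k _; congr (_ * _).
rewrite /contr; case: ifPn => [kK|kK]; first by rewrite (pd_antiholomorphic _ e0 kK).
rewrite /del (bigD1 k) ?setU11 //= setU1K // big1 ?addr0.
  exact: (sign_mul_id (pd a (lshift n k) (e K) x : C^o)).
move=> l /andP[_ lk].
rewrite (pd_antiholomorphic (k := k) _ e0) ?mul0rz //.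
by apply: lshift_in_setD; rewrite (inj_eq (@lshift_inj _ _)).
Qed.

Lemma chern_singleton (k : 'I_n) :
  chern h a [set lshift n k]%SET x =
  invmx (hbar h a x) *m pdM a (lshift n k) (hbar h a) x.
Proof.
rewrite /chern (big_pred1 k) // => l /=.
by rewrite (inj_eq finset.set1_inj) (inj_eq (@lshift_inj _ _)) eq_sym.
Qed.

Lemma chern0 (k : 'I_n) J : lshift n k \in J -> J != [set lshift n k]%SET ->
  chern h a J x = 0.
Proof.
move=> kJ Jk; apply: big1 => l /eqP Jl; move: kJ Jk; rewrite Jl inE.
by move=> /eqP <-; rewrite eqxx.
Qed.

(** In the component k |: J, the only surviving splitting gives dz^k to the derivative or to the
    connection matrix, and J to B. The factor (-1)^q of [nablaQ] compensates for moving dz^k across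
    the q indices of J. *)
Lemma contr_nablaQ (q : nat) (B : lform X 'M[C]_r) (k : 'I_n) J :
    antiholomorphic B -> (#|J| != q -> B J x = 0) ->
  contr (lshift n k) (nablaQ h a q B) J x =
  pdM a (lshift n k) (B J) x +
  (chern h a [set lshift n k]%SET x *m B J x - B J x *m chern h a [set lshift n k]%SET x).
Proof.
move=> B0 Bq; rewrite /contr; case: ifPn => [kJ|kJ].
  by rewrite (pdM_antiholomorphic _ B0 kJ) (B0 _ _ _ ax kJ) mulmx0 mul0mx subrr addr0.
set K := lshift n k |: J.
have KJ : K :\ lshift n k = J by rewrite setU1K.
have kK : lshift n k \in K by rewrite setU11.
have E1 : dformM a B K x = pdM a (lshift n k) (B J) x *~ (-1) ^+ ninv [set lshift n k]%SET J.
  rewrite /dformM (bigD1 (lshift n k)) //= KJ big1 ?addr0 // => i /andP[_ ik].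
  by rewrite (pdM_antiholomorphic (k := k) _ B0) ?mul0rz // lshift_in_setD.
have E2 : wedgeM (chern h a) B K x =
    (chern h a [set lshift n k]%SET x *m B J x) *~ (-1) ^+ ninv [set lshift n k]%SET J.
  rewrite /wedgeM /wedge_op (bigD1 [set lshift n k]%SET); last by rewrite finset.sub1set.
  rewrite KJ big1 /=; first by rewrite addr0.
  move=> I /andP[IK Ik].
  have [kI|kI] := boolP (lshift n k \in I).
    by rewrite (chern0 kI Ik) mul0mx mul0rz.
  by rewrite (B0 k (K :\: I) x) ?mulmx0 ?mul0rz // inE kI.
have E3 : wedgeM B (chern h a) K x =
    (B J x *m chern h a [set lshift n k]%SET x) *~ (-1) ^+ ninv J [set lshift n k]%SET.
  have KDJ : K :\: J = [set lshift n k]%SET.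
    apply/setP => i; rewrite !inE; have [->|] := eqVneq i (lshift n k).
      by rewrite kJ.
    by move=> _; case: (i \in J).
  rewrite /wedgeM /wedge_op (bigD1 J); last exact: finset.subsetUr.
  rewrite KDJ big1 /=; first by rewrite addr0.
  move=> I /andP[IK IJ].
  have [kI|kI] := boolP (lshift n k \in I).
    by rewrite (B0 k I x ax kI) mul0mx mul0rz.
  rewrite (@chern0 k) ?mulmx0 ?mul0rz //; first by rewrite inE kI.
  apply: contra IJ => /eqP KI; apply/eqP.
  by rewrite -KJ -KI finset.setDDr finset.setDv finset.set0U; apply/esym/finset.setIidPr.
rewrite -[nablaQ h a q B K x]/(dformM a B K x + wedgeM (chern h a) B K x -
  (-1) ^+ q *: wedgeM B (chern h a) K x) E1 E2 E3.
(* Outside degree q the matrix products vanish at x. The derivative remains on both sides, as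
   vanishing is assumed at x only. *)
have [Jq|/Bq ->] := eqVneq #|J| q; last first.
  by rewrite mulmx0 mul0mx !mul0rz scaler0 !subr0 !addr0 sign_mul_id.
rewrite mulrzBl mulrzDl !sign_mul_id -addrA; congr (_ + (_ - _)).
have dJ : [disjoint [set lshift n k]%SET & J]%B by rewrite disjoints1.
rewrite -Jq !mulrz_sign !scalerA -!exprD.
have := ninvD dJ; rewrite cards1 mul1n => <-.
set s := ninv _ J; set t := ninv J _.
by rewrite addnA addnn -addnA addnn -doubleD -signr_odd odd_double scale1r.
Qed.

End LocalForms.

(** * The terms of the bracket on A(E)-valued tensors *)

Section BracketOfTensors.
Context {R : realType} {n r : nat} {X : complexManifold R n} {E : holBundle X r}.
Variable h : hermMetric E.
Context {a : chart X} {x : pt X} (ax : dom a x).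
Local Notation C := R[i].
Local Notation idx := {set 'I_(n + n)}.
Local Notation sub := (@subset_refl _ (dom a)).
Implicit Types (I J K : idx) (w e : lform X C).

Lemma theta_chern (v : 'rV[C]_n) :
  theta h a v x = \sum_(k < n) v 0 k *: chern h a [set lshift n k]%SET x.
Proof.
rewrite /theta vecM_pdM mulmx_sumr; apply: eq_bigr => k _.
by rewrite -scalemxAr chern_singleton.
Qed.

(** The Leibniz rule on e_J G: differentiating e_J gives the Lie derivative term of [bracketD], and
    differentiating G gives its covariant derivative along v. *)
Lemma contr_form_nablaQ (w e : lform X C) (v : pt X -> 'rV[C]_n) (G : pt X -> 'M[C]_r)
    (q : nat) K :
    antiholomorphic (a := a) e -> (forall J, smooth a (dom a) (e J)) ->
    (forall J, #|J| != q -> e J x = 0) -> smoothM a (dom a) G ->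
  contr_form (fun J y => w J y *: v y) (nablaQ h a q (fun J y => e J y *: G y)) K x =
  wedge w (fun J y => vec a (v y) (e J) y) K x *: G x +
  wedge w e K x *: (vecM a (v x) G x +
    (theta h a (v x) x *m G x - G x *m theta h a (v x) x)).
Proof.
move=> e0 se eq sG; pose B : lform X 'M[C]_r := fun J y => e J y *: G y.
have B0 : antiholomorphic (a := a) B.
  by move=> k J y ay kJ; rewrite /B (e0 k J y ay kJ) scale0r.
have Bq J : #|J| != q -> B J x = 0 by move=> /eq Jq; rewrite /B Jq scale0r.
rewrite /contr_form /wedgeZ /wedge_op exchange_big -!sum_wedgeZ -big_split.
apply: eq_bigr => I _ /=.
have D J : \sum_(k < n) v x 0 k *: contr (lshift n k) (nablaQ h a q B) J x =
    vec a (v x) (e J) x *: G x + e J x *: (vecM a (v x) G x +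
      (theta h a (v x) x *m G x - G x *m theta h a (v x) x)).
  under eq_bigr do rewrite (contr_nablaQ h ax _ B0 (@Bq J)) scalerDr scalerBr.
  rewrite big_split sumrB -vecM_pdM (vecMZ (dom_open a) sub ax _ (se J) sG) /=.
  under eq_bigr do rewrite scalemxAl.
  under [X in _ + (_ - X)]eq_bigr do rewrite scalemxAr.
  rewrite -mulmx_suml -mulmx_sumr -theta_chern /B -scalemxAl -scalemxAr -scalerBr.
  by rewrite -addrA -scalerDr.
rewrite -mulrzDl -[in RHS]scalerA -[in RHS]scalerA -scalerDr -D.
rewrite scaler_sumr mulrz_suml; apply: eq_bigr => k _.
by rewrite mxE scalerA.
Qed.

Lemma wedgeM_tensor (w e : lform X C) (A B : pt X -> 'M[C]_r) K :
  wedgeM (fun J y => w J y *: A y) (fun J y => e J y *: B y) K x =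
  wedge w e K x *: (A x *m B x).
Proof.
rewrite -sum_wedgeZ; apply: eq_bigr => I _.
by rewrite -scalemxAl -scalemxAr scalerA.
Qed.

(** The Leibniz rule for [w_I v, e_J u], summed over the splittings of K. The two terms in which
    form coefficients are differentiated are the symbols of the Lie derivative terms. *)
Lemma wedge_vf_bracket (w e : lform X C) (v u : pt X -> 'rV[C]_n) K :
    (forall J, smooth a (dom a) (w J)) -> (forall J, smooth a (dom a) (e J)) ->
    smoothM a (dom a) v -> smoothM a (dom a) u ->
  wedge_op (vf_bracket a) (fun J y => w J y *: v y) (fun J y => e J y *: u y) K x =
  wedge w e K x *: vf_bracket a v u x +
  wedge w (fun J y => vec a (v y) (e J) y) K x *: u x -
  wedge (fun J y => vec a (u y) (w J) y) e K x *: v x.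
Proof.
move=> sw se sv su; rewrite -!sum_wedgeZ -big_split -sumrB.
apply: eq_bigr => I _ /=; rewrite -mulrzDl -mulrzBl.
apply: (congr1 (fun z => z *~ _)).
apply/rowP => k; rewrite !mxE.
have D (f : pt X -> C) (t z : pt X -> 'rV[C]_n) (c : C) : smooth a (dom a) f ->
    smoothM a (dom a) z ->
    vec a (c *: t x) (fun y => (f y *: z y) 0 k) x =
    c * (vec a (t x) f x * z x 0 k + f x * vec a (t x) (fun y => z y 0 k) x).
  move=> sf sz; rewrite vecZv -(vecMl sub ax _ sf (sz 0 k)).
  by apply: (congr1 ( *%R c)); apply: (eq_vec (dom_open a) sub ax) => y _; rewrite mxE.
rewrite (D _ _ _ _ (se _) su) (D _ _ _ _ (sw _) sv).
move: (vec _ _ _ _) (vec _ _ _ _) (vec _ _ _ _) (vec _ _ _ _) => p1 p2 p3 p4.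
by move: (w I x) (e _ x) (v x 0 k) (u x 0 k) => p5 p6 p7 p8; ring.
Qed.

End BracketOfTensors.

(** * The intertwining identity *)

Section BracketIdentity.
Context {R : realType} {n r : nat} {X : complexManifold R n} {E : holBundle X r}.
Variable h : hermMetric E.
Local Notation C := R[i].
Implicit Types (a : chart X) (x : pt X) (P S : lsec X (r := r)).

(** The End(E) component of the identity for forms of degree zero, to which the general case reduces
    once form coefficients are factored out. *)
Lemma Phi_local_commutator P S a x : smooth_fib P -> smooth_fib S -> dom a x ->
  let v := (P a x).2 in let u := (S a x).2 in
  let G T := fun y => (Phi_sec h T a y).1 in
  (Phi h a x (local_commutator P S a x)).1 =
  vecM a v (G S) x + (theta h a v x *m G S x - G S x *m theta h a v x) -
  (vecM a u (G P) x + (theta h a u x *m G P x - G P x *m theta h a u x)) +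
  (G P x *m G S x - G S x *m G P x).
Proof.
move=> sP sS ax v u G; have [p1 p2] := sP a; have [s1 s2] := sS a.
have da := dom_open a; have sub := @subset_refl _ (dom a).
have st1 := smooth_theta h p2; have st2 := smooth_theta h s2.
have GE T y : G T y = (T a y).1 - theta h a (T a y).2 y by [].
have -> : vecM a v (G S) x =
    vecM a v (fun y => (S a y).1) x - vecM a v (fun y => theta h a (S a y).2 y) x.
  exact: (vecMB da sub ax _ s1 st2).
have -> : vecM a u (G P) x =
    vecM a u (fun y => (P a y).1) x - vecM a u (fun y => theta h a (P a y).2 y) x.
  exact: (vecMB da sub ax _ p1 st1).
have flat := theta_flat h ax p2 s2.
rewrite PhiE /local_commutator /= !GE.
move: flat; rewrite -/v -/u.
move: (theta h a v x) (theta h a u x) (theta h a (vf_bracket _ _ _ _) x) => tv tu tvu.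
move: (P a x).1 (S a x).1 => gP gS.
move: (vecM a v _ x) (vecM a u _ x) (vecM a v _ x) (vecM a u _ x) => d1 d2 d3 d4 flat.
(* Flatness eliminates [theta] of the bracket; the rest is additive algebra with the matrix products
   as independent unknowns. *)
have -> : tvu = d3 - d4 + (tv *m tu - tu *m tv) by rewrite flat subrK.
rewrite !(mulmxBl, mulmxBr).
move: (gP *m gS) (gS *m gP) (tv *m tu) (tu *m tv) => m1 m2 m3 m4.
move: (tv *m gS) (gS *m tv) (tu *m gP) (gP *m tu) => m5 m6 m7 m8.
by apply/matrixP => i j; rewrite !mxE; ring.
Qed.

Lemma Omega0_antiholomorphic (p : nat) (w : chart X -> lform X C) a :
  Omega0 p w -> antiholomorphic (a := a) (w a).
Proof.
move=> [_ w0 _] k J y ay kJ; apply: w0 => //; apply/nandP; left.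
by apply/subsetPn; exists (lshift n k) => //; exact: lshift_notin_bars.
Qed.

Lemma Omega0_degree (p : nat) (w : chart X -> lform X C) a y (J : {set 'I_(n + n)}) :
  Omega0 p w -> dom a y -> #|J| != p -> w a J y = 0.
Proof. by move=> [_ w0 _] ay Jp; apply: w0 => //; apply/nandP; right. Qed.

Lemma Phi_bracket (p q : nat) (phi psi : chart X -> lform X C) P S a K x :
    (0 < r)%N -> Omega0 p phi -> Omega0 q psi -> D1_section E P -> D1_section E S ->
    dom a x ->
  Phi_form h (bracketD E p q phi P psi S) a K x =
  bracketH h p q (tensor phi (Phi_sec h P)) (tensor psi (Phi_sec h S)) a K x.
Proof.
move=> r0 Op Oq DP DS ax.
have [sP _] := DP; have [sS _] := DS.
have [p1 p2] := sP a; have [s1 s2] := sS a.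
have da := dom_open a; have sub := @subset_refl _ (dom a).
pose w := phi a; pose e := psi a.
have sw J : smooth a (dom a) (w J) by case: Op.
have se J : smooth a (dom a) (e J) by case: Oq.
have w0 : antiholomorphic (a := a) w := Omega0_antiholomorphic (a := a) Op.
have e0 : antiholomorphic (a := a) e := Omega0_antiholomorphic (a := a) Oq.
have wp (J : {set 'I_(n + n)}) : #|J| != p -> w J x = 0 by exact: (Omega0_degree Op ax).
have eq (J : {set 'I_(n + n)}) : #|J| != q -> e J x = 0 by exact: (Omega0_degree Oq ax).
pose v y := (P a y).2; pose u y := (S a y).2.
pose GP y := (Phi_sec h P a y).1; pose GS y := (Phi_sec h S a y).1.
have [sGP _] := (smooth_fib_Phi h P).2 sP a.
have [sGS _] := (smooth_fib_Phi h S).2 sS a.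
pose ve : lform X C := fun J y => vec a (v y) (e J) y.
pose uw : lform X C := fun J y => vec a (u y) (w J) y.
(* The degree condition on phi holds on all of [dom a], so it passes to derivatives of the
   coefficients. *)
have uwp (J : {set 'I_(n + n)}) : #|J| != p -> uw J x = 0.
  move=> Jp; rewrite /uw (eq_vec da sub ax _ (g := fun=> 0)) ?vec_cst //.
  by move=> y ay; exact: (Omega0_degree Op ay Jp).
have lieE (t : pt X -> 'rV[C]_n) (f g : lform X C) : antiholomorphic (a := a) g ->
    wedge f (lie a t g) K x = wedge f (fun J y => vec a (t y) (g J) y) K x.
  move=> g0; apply: eq_bigr => I _.
  by rewrite (lie_antiholomorphic ax _ _ g0).
set eps : C := (-1) ^+ (p * q).
have epsK (c : C) : eps * (eps * c) = c.
  by rewrite mulrA -exprD addnn -signr_odd odd_double mul1r.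
have cwe : wedge e w K x = eps * wedge w e K x by rewrite (wedgeC K wp eq) epsK.
(* The differentiated w is the left factor in the bracket of vector fields and the right factor in
   [bracketD]. *)
have cuw : wedge uw e K x = eps * wedge e uw K x by exact: wedgeC.
have [linPhi _] := (Phi_is_isomorphism h r0).1 a x ax.
have Phi0 : Phi h a x 0 = 0.
  by have := linPhi (-1) 0 0; rewrite scaler0 addr0 scaleN1r addNr.
have PhiZ (c : C) A : Phi h a x (c *: A) = c *: Phi h a x A.
  by rewrite -[c *: A]addr0 linPhi Phi0 addr0.
pose al := wedge w e K x; pose be := wedge w ve K x; pose ga := wedge e uw K x.
have LHS_E : Phi_form h (bracketD E p q phi P psi S) a K x =
    al *: Phi h a x (local_commutator P S a x) +
    be *: Phi_sec h S a x - eps *: (ga *: Phi_sec h P a x).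
  have lin3 (c1 c2 c3 c2' c3' : C) A A' B D : A = A' -> c2 = c2' -> c3 = c3' ->
      Phi h a x (c1 *: A + c2 *: B - eps *: (c3 *: D)) =
      c1 *: Phi h a x A' + c2' *: Phi h a x B - eps *: (c3' *: Phi h a x D).
    by move=> -> -> ->; rewrite -!scaleNr !scalerA -addrA linPhi linPhi PhiZ addrA.
  exact: lin3 (commutatorE r0 DP DS ax) (lieE (symbol P a) w e e0) (lieE (symbol S a) e w w0).
have RHS_E : bracketH h p q (tensor phi (Phi_sec h P)) (tensor psi (Phi_sec h S)) a K x =
   (contr_form (fun J y => w J y *: v y) (nablaQ h a q (fun J y => e J y *: GS y)) K x -
    eps *: contr_form (fun J y => e J y *: u y) (nablaQ h a p (fun J y => w J y *: GP y)) K x +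
    (wedgeM (fun J y => w J y *: GP y) (fun J y => e J y *: GS y) K x -
     eps *: wedgeM (fun J y => e J y *: GS y) (fun J y => w J y *: GP y) K x),
    wedge_op (vf_bracket a) (fun J y => w J y *: v y) (fun J y => e J y *: u y) K x).
  by [].
pose MS := vecM a (v x) GS x + (theta h a (v x) x *m GS x - GS x *m theta h a (v x) x).
pose MP := vecM a (u x) GP x + (theta h a (u x) x *m GP x - GP x *m theta h a (u x) x).
have E1 : contr_form (fun J y => w J y *: v y)
    (nablaQ h a q (fun J y => e J y *: GS y)) K x = be *: GS x + al *: MS.
  exact: (contr_form_nablaQ h ax w v K e0 se eq sGS).
have E2 : contr_form (fun J y => e J y *: u y)
    (nablaQ h a p (fun J y => w J y *: GP y)) K x = ga *: GP x + (eps * al) *: MP.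
  apply: etrans (contr_form_nablaQ h ax e u K w0 sw wp sGP) _.
  exact: (congr1 (fun c => ga *: GP x + c *: MP) cwe).
have E3 : wedgeM (fun J y => w J y *: GP y) (fun J y => e J y *: GS y) K x =
    al *: (GP x *m GS x) by exact: wedgeM_tensor.
have E4 : wedgeM (fun J y => e J y *: GS y) (fun J y => w J y *: GP y) K x =
    (eps * al) *: (GS x *m GP x).
  apply: etrans (wedgeM_tensor e w GS GP K) _.
  exact: (congr1 (fun c => c *: (GS x *m GP x)) cwe).
have E5 : wedge_op (vf_bracket a) (fun J y => w J y *: v y) (fun J y => e J y *: u y) K x =
    al *: vf_bracket a v u x + be *: u x - (eps * ga) *: v x.
  apply: etrans (wedge_vf_bracket ax K sw se p2 s2) _.
  exact: (congr1 (fun c => al *: vf_bracket a v u x + be *: u x - c *: v x) cuw).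
have shape (t1 t2 t3 t4 t1' t2' t3' t4' : 'M[C]_r) (t5 t5' : 'rV[C]_n) :
    t1 = t1' -> t2 = t2' -> t3 = t3' -> t4 = t4' -> t5 = t5' ->
    (t1 - eps *: t2 + (t3 - eps *: t4), t5) = (t1' - eps *: t2' + (t3' - eps *: t4'), t5').
  by move=> -> -> -> -> ->.
apply: etrans LHS_E _; apply/esym; apply: etrans RHS_E _.
apply: etrans (shape _ _ _ _ _ _ _ _ _ _ E1 E2 E3 E4 E5) _; apply/esym.
have C1 : (Phi h a x (local_commutator P S a x)).1 =
    MS - MP + (GP x *m GS x - GS x *m GP x) := Phi_local_commutator sP sS ax.
(* Each [eps * al], produced by exchanging w and e, meets an outer [eps] and becomes [al]; what
   remains is [al] times the degree-zero identity [C1]. *)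
have collect (c g1 g2 m1 m2 m3 m4 : 'M[C]_r) : c = m1 - m2 + (m3 - m4) ->
    al *: c + be *: g1 - eps *: (ga *: g2) =
    be *: g1 + al *: m1 - eps *: (ga *: g2 + (eps * al) *: m2) +
    (al *: m3 - eps *: ((eps * al) *: m4)).
  move=> ->; rewrite !(scalerDr, scalerA, epsK, scalerN) opprD.
  move: (al *: m1) (al *: m2) (al *: m3) (al *: m4) (be *: g1) (_ *: g2).
  by move=> k1 k2 k3 k4 k5 k6; apply/matrixP => i j; rewrite !mxE; ring.
apply: injective_projections; first exact: collect C1.
have assocZ (c1 c2 : 'rV[C]_n) : c1 + be *: u x - eps *: (ga *: c2) =
    c1 + be *: u x - (eps * ga) *: c2 by rewrite scalerA.
exact: (assocZ (al *: vf_bracket a v u x) (v x)).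
Qed.

End BracketIdentity.

Theorem theoremA3 (R : realType) (n r : nat) (X : complexManifold R n)
    (E : holBundle X r) (h : hermMetric E) :
  compact [set: pt X] -> (0 < r)%N ->
  Phi_isomorphism h /\
  forall (p q : nat) (phi psi : chart X -> lform X R[i]) (P S : lsec X),
    Omega0 p phi -> Omega0 q psi -> D1_section E P -> D1_section E S ->
    forall (a : chart X) (K : {set 'I_(n + n)}) (x : pt X), dom a x ->
      Phi_form h (bracketD E p q phi P psi S) a K x =
      bracketH h p q (tensor phi (Phi_sec h P)) (tensor psi (Phi_sec h S)) a K x.
Proof.
move=> _ r0; split; first exact: Phi_is_isomorphism.
by move=> p q phi psi P S Op Oq DP DS a K x ax; exact: Phi_bracket.
Qed.
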